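(* The following are equivalent for a monoid $M$. (1) $M$ is of type bi-$\mathrm F_1$. (2) $M$ is of type bi-$\mathrm{FP}_1$. (3) There is a finite subset $A\subseteq M$ such that the natural mapping $\pi_0(\overleftrightarrow{\Gamma(M,A)})\to M$ is an isomorphism. (4) There is a finite subset $A\subseteq M$ that dominates $M$. In particular, any finitely generated monoid is of type bi-$\mathrm F_1$.
   Context: For $A\subseteq M$, the two-sided Cayley digraph $\overleftrightarrow{\Gamma(M,A)}$ has vertex set $M\times M$ and edges in bijection with $M\times M\times A$, the edge $(m_L,m_R,a)$ going from $(m_L,am_R)$ to $(m_La,m_R)$. It carries an action of $M\times M^{op}$ given on vertices by $(m,m')(m_1,m_2)=(mm_1,m_2m')$. If two vertices $(m_1,m_2)$, $(m_1',m_2')$ are joined by an edge then $m_1m_2=m_1'm_2'$; the natural mapping $\pi_0(\overleftrightarrow{\Gamma(M,A)})\to M$ sends the (undirected) connected component of $(m_1,m_2)$ to $m_1m_2$; it is a surjective $M\times M^{op}$-equivariant map, where $M$ is an $M\times M^{op}$-set via $(m_L,m_R)m=m_Lmm_R$. A subset $A\subseteq M$ dominates $M$ if whenever $f,g\colon M\to N$ are monoid homomorphisms with $f|_A=g|_A$, one has $f=g$. For a monoid $N$ (discrete topology), an $N$-set $P$ (set with left $N$-action) is projective if every surjective $N$-equivariant map onto $P$ has an $N$-equivariant section; equivalently $P\cong\coprod_{a}Ne_a$ with each $e_a\in N$ idempotent. A projective $N$-CW complex is a space with continuous left $N$-action $X=\varinjlim X_n$ (along inclusions) where $X_0=P_0$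 is a projective $N$-set (discrete) and, for $n\ge1$, $X_n$ is a pushout $X_n=X_{n-1}\cup_{P_n\times S^{n-1}}(P_n\times B^n)$ of $N$-spaces along an $N$-equivariant continuous map $P_n\times S^{n-1}\to X_{n-1}$, with $P_n$ a projective $N$-set and $B^n$, $S^{n-1}$ carrying trivial actions. $X_n$ is $N$-finite if $P_0,\dots,P_n$ are finitely generated. A bi-equivariant classifying space for $M$ is a projective $M\times M^{op}$-CW complex $X$ such that $\pi_0(X)\cong M$ as an $M\times M^{op}$-set and each component of $X$ is contractible. $M$ is of type bi-$\mathrm F_n$ ($0\le n<\infty$) if it has a bi-equivariant classifying space $X$ with $X_n$ $M\times M^{op}$-finite. $M$ is of type bi-$\mathrm{FP}_n$ if there is an exact sequence of $(\mathbb ZM,\mathbb ZM)$-bimodules $A_n\to\cdots\to A_0\to\mathbb ZM\to0$ with all $A_i$ finitely generated projective bimodules. *)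

(* Defs.v *)
From HB Require Import structures.
From mathcomp Require Import all_boot all_order all_algebra generic_quotient.
From mathcomp Require Import finmap.
From mathcomp Require Import all_classical reals topology normedtype.
From mathcomp Require Import continuous_path.
From Stdlib Require Import Relation_Operators.

Set Implicit Arguments.
Unset Strict Implicit.
Unset Printing Implicit Defensive.

Import Order.TTheory GRing.Theory Num.Theory.
Import numFieldNormedType.Exports.

Local Open Scope classical_set_scope.
Local Open Scope ring_scope.
Local Open Scope quotient_scope.

Definition monoid_fg (M : monoidType) : Prop :=
  exists2 A : set M, finite_set A &
    forall m, exists2 s : seq M, (forall a, a \in s -> A a) &
      m = (\prod_(a <- s) a)%g.

Definition dominates (M : monoidType) (A : set M) : Prop :=
  forall (N : monoidType) (f g : UMagmaMorphism.type M N),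
    (forall a, A a -> f a = g a) -> f =1 g.

Definition opmonoid (M : Type) : Type := M.

Section Opmonoid.
Context (M : monoidType).
HB.instance Definition _ := Choice.on (opmonoid M).
Let mul (x y : opmonoid M) : opmonoid M := ((y : M) * (x : M))%g.
Fact opmulA : associative mul.
Proof. by move=> x y z; rewrite /mul mulgA. Qed.
Fact opmul1 : left_id (1%g : M) mul.
Proof. by move=> x; rewrite /mul mulg1. Qed.
Fact op1mul : right_id (1%g : M) mul.
Proof. by move=> x; rewrite /mul mul1g. Qed.
HB.instance Definition _ := isMonoid.Build (opmonoid M) opmulA opmul1 op1mul.
End Opmonoid.

Notation bimonoid M := (M * opmonoid M)%type.

HB.mixin Record isNSet (N : monoidType) T & Choice T := {
  nact : N -> T -> T;
  nact1 : forall x, nact 1%g x = x;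
  nactM : forall a b x, nact (a * b)%g x = nact a (nact b x)
}.

#[short(type="nsetType")]
HB.structure Definition NSet (N : monoidType) :=
  {T of Choice T & isNSet N T}.

Section NSets.
Context (N : monoidType).

Definition equivariant (P Q : nsetType N) (f : P -> Q) : Prop :=
  forall a x, f (nact a x) = nact a (f x).

Definition is_nset_iso (P Q : nsetType N) (f : P -> Q) : Prop :=
  equivariant f /\
  exists g : Q -> P, [/\ equivariant g, cancel f g & cancel g f].

Definition nset_projective (P : nsetType N) : Prop :=
  forall (Q : nsetType N) (f : Q -> P),
    equivariant f -> (forall y, exists x, f x = y) ->
    exists2 s : P -> Q, equivariant s & cancel s f.

Definition nset_fg (P : nsetType N) : Prop :=
  exists2 S : set P, finite_set S &
    forall x, exists a, exists2 y, S y & x = nact a y.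

End NSets.

Section NSetQuotient.
Context (N : monoidType) (T : nsetType N) (e : equiv_rel T).
Hypothesis e_nact : forall a x y, e x y -> e (nact a x) (nact a y).

Definition quot_nact (a : N) (C : {eq_quot e}) : {eq_quot e} :=
  \pi_(_) (nact a (repr C)).

Lemma quot_nactE a x : quot_nact a (\pi_(_) x) = \pi_(_) (nact a x).
Proof. by apply/eqmodP/e_nact/eqmodP; rewrite reprK. Qed.

Lemma quot_nact1 C : quot_nact 1%g C = C.
Proof. by rewrite -[C]reprK quot_nactE nact1. Qed.

Lemma quot_nactM a b C : quot_nact (a * b)%g C = quot_nact a (quot_nact b C).
Proof. by rewrite -[C]reprK !quot_nactE nactM. Qed.

End NSetQuotient.

(** Alias of M carrying the action (m_L, m_R) m = m_L m m_R of M x M^op. *)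
Definition biset (M : Type) : Type := M.

Section Biset.
Context (M : monoidType).
HB.instance Definition _ := Choice.on (biset M).
Definition biset_act (a : bimonoid M) (m : biset M) : biset M :=
  ((a.1 : M) * (m : M) * (a.2 : M))%g.
Fact biset_act1 m : biset_act 1%g m = m.
Proof. by rewrite /biset_act mul1g; exact: mulg1. Qed.
Fact biset_actM a b m :
  biset_act (a * b)%g m = biset_act a (biset_act b m).
Proof. by rewrite /biset_act /= !mulgA. Qed.
HB.instance Definition _ :=
  isNSet.Build (bimonoid M) (biset M) biset_act1 biset_actM.
End Biset.

Record digraph := Digraph {
  vertex : choiceType;
  edge : Type;
  source : edge -> vertex;
  target : edge -> vertex
}.

Section DigraphComponents.
Context (G : digraph).

Definition adjacent (x y : vertex G) : Prop :=
  exists u : edge G, source u = x /\ target u = y.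

Definition joined : rel (vertex G) :=
  fun x y => `[< clos_refl_sym_trans _ adjacent x y >].

Fact joined_refl : reflexive joined.
Proof. by move=> x; apply/asboolP; exact: rst_refl. Qed.
Fact joined_sym : symmetric joined.
Proof. by move=> x y; apply/asboolP/asboolP; exact: rst_sym. Qed.
Fact joined_trans : transitive joined.
Proof. by move=> y x z /asboolP xy /asboolP yz; apply/asboolP; exact: rst_trans yz. Qed.

Definition joined_equiv := EquivRel joined joined_refl joined_sym joined_trans.

Definition digraph_pi0 : Type := {eq_quot joined_equiv}.
End DigraphComponents.

Definition cayley_vertex (M : Type) : Type := (M * M)%type.

Section CayleyVertex.
Context (M : monoidType).
HB.instance Definition _ := Choice.on (cayley_vertex M).
Definition cayley_act (a : bimonoid M) (v : cayley_vertex M) :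
  cayley_vertex M := ((a.1 : M) * v.1, v.2 * (a.2 : M))%g.
Fact cayley_act1 v : cayley_act 1%g v = v.
Proof. by case: v => x y; congr pair; rewrite ?mul1g//; exact: mulg1. Qed.
Fact cayley_actM a b v :
  cayley_act (a * b)%g v = cayley_act a (cayley_act b v).
Proof. by rewrite /cayley_act /= !mulgA. Qed.
HB.instance Definition _ :=
  isNSet.Build (bimonoid M) (cayley_vertex M) cayley_act1 cayley_actM.
End CayleyVertex.

Definition two_sided_cayley (M : monoidType) (A : set M) : digraph :=
  @Digraph (cayley_vertex M) (M * M * A)%type
    (fun e => (e.1.1, val e.2 * e.1.2)%g)
    (fun e => (e.1.1 * val e.2, e.1.2)%g).

Section CayleyComponents.
Context (M : monoidType) (A : set M).
Let V : nsetType (bimonoid M) := cayley_vertex M.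
Let e : equiv_rel V := joined_equiv (two_sided_cayley A).

Fact cayley_joined_act a x y : e x y -> e (nact a x) (nact a y).
Proof.
move=> /asboolP xy; apply/asboolP.
elim: xy => {x y} [x y [[[m1 m2] s] /= [<- <-]]|x|x y _ ih|x y z _ ih1 _ ih2].
- apply: rst_step; exists (a.1 * m1, m2 * (a.2 : M), s)%g => /=.
  by rewrite /nact /= /cayley_act /= !mulgA.
- exact: rst_refl.
- exact: rst_sym.
- exact: rst_trans ih2.
Qed.

Definition cayley_pi0 : Type := digraph_pi0 (two_sided_cayley A).
HB.instance Definition _ := Choice.on cayley_pi0.
HB.instance Definition _ := isNSet.Build (bimonoid M) cayley_pi0
  (quot_nact1 cayley_joined_act) (quot_nactM cayley_joined_act).

Definition cayley_pi0_map (C : cayley_pi0) : biset M :=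
  let v : cayley_vertex M := repr C in (v.1 * v.2)%g.

Lemma cayley_joined_mul (x y : V) : e x y -> (x.1 * x.2 = y.1 * y.2)%g.
Proof.
move=> /asboolP; elim => {x y} [x y [[[m1 m2] s] /= [<- <-]]//=|//|//|].
  by rewrite mulgA.
by move=> x y z _ -> _.
Qed.

Lemma cayley_pi0_mapE (v : V) :
  cayley_pi0_map (\pi_(_) v) = (v.1 * v.2)%g.
Proof. by apply: cayley_joined_mul; apply/eqmodP; rewrite reprK. Qed.

Lemma cayley_pi0_map_equivariant : equivariant cayley_pi0_map.
Proof.
move=> a C; rewrite -[C]reprK [nact _ _](quot_nactE cayley_joined_act).
by rewrite !cayley_pi0_mapE /nact /= /cayley_act /biset_act /= !mulgA.
Qed.

End CayleyComponents.

HB.mixin Record NSet_isNSpace (N : monoidType) T & NSet N T & Topological T := {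
  nact_continuous :
    continuous (fun p : discrete_topology N * T => nact p.1 p.2)
}.

#[short(type="nspaceType")]
HB.structure Definition NSpace (N : monoidType) :=
  {T of Topological T & NSet N T & NSet_isNSpace N T}.

Lemma discrete_prod_continuous (N : choiceType) (T U : topologicalType)
    (f : N -> T -> U) :
  (forall a, continuous (f a)) ->
  continuous (fun p : discrete_topology N * T => f p.1 p.2).
Proof.
move=> cf [a x] W /= /(cf a x) Wx.
exists ([set a], [set y | W (f a y)]) => //=.
  by split => //; rewrite nbhs_principalE; apply/principal_filterP.
by case=> b y /= [-> ].
Qed.

Section DiscreteNSpace.
Context (N : monoidType) (P : nsetType N).
HB.instance Definition _ := isNSet.Build N (discrete_topology P)
  (@nact1 N P) (@nactM N P).
Fact discrete_nact_continuous :
  continuous (fun p : discrete_topology N * discrete_topology P =>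
    nact p.1 p.2).
Proof.
apply: discrete_prod_continuous => a x W /=.
by rewrite /nbhs /= => /principal_filterP Wx; apply/principal_filterP.
Qed.
HB.instance Definition _ := NSet_isNSpace.Build N (discrete_topology P)
  discrete_nact_continuous.
End DiscreteNSpace.

(** [cells P B] is P x B, with P discrete and N acting trivially on B. *)
Definition cells (P : Type) (B : Type) : Type := (discrete_topology P * B)%type.

Section Cells.
Context (N : monoidType) (P : nsetType N) (B : topologicalType).
HB.instance Definition _ := Topological.on (cells P B).
Definition cells_act (a : N) (x : cells P B) : cells P B := (nact a x.1, x.2).
Fact cells_act1 x : cells_act 1%g x = x.
Proof. by case: x => p b; rewrite /cells_act nact1. Qed.
Fact cells_actM a b x : cells_act (a * b)%g x = cells_act a (cells_act b x).
Proof. by rewrite /cells_act nactM. Qed.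
HB.instance Definition _ := isNSet.Build N (cells P B) cells_act1 cells_actM.
Fact cells_act_continuous :
  continuous (fun p : discrete_topology N * cells P B => nact p.1 p.2).
Proof.
apply: discrete_prod_continuous => a [p b].
move=> W [[U V] /= [Up Vb] UVW]; exists ([set p], V) => /=.
  by split => //; rewrite nbhs_principalE; apply/principal_filterP.
case=> q c /= [-> Vc]; apply: UVW; split => //=.
by move: Up; rewrite nbhs_principalE => /principal_filterP.
Qed.
HB.instance Definition _ := NSet_isNSpace.Build N (cells P B)
  cells_act_continuous.
End Cells.

Definition cells_map (P B C : Type) (f : B -> C) (x : cells P B) : cells P C :=
  (x.1, f x.2).

Section NSpaces.
Context (N : monoidType).

Definition nmap (X Y : nspaceType N) (f : X -> Y) : Prop :=
  continuous f /\ equivariant f.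

Definition is_nspace_iso (X Y : nspaceType N) (f : X -> Y) : Prop :=
  nmap f /\ exists g : Y -> X, [/\ nmap g, cancel f g & cancel g f].

Definition is_nspace_pushout (S B X Y : nspaceType N) (i : S -> B) (f : S -> X)
    (j : X -> Y) (g : B -> Y) : Prop :=
  [/\ nmap j, nmap g, j \o f =1 g \o i &
    forall (Z : nspaceType N) (u : X -> Z) (v : B -> Z),
      nmap u -> nmap v -> u \o f =1 v \o i ->
      exists! h : Y -> Z, [/\ nmap h, h \o j =1 u & h \o g =1 v]].

Definition is_nspace_colim (X : nat -> nspaceType N)
    (i : forall n, X n -> X n.+1) (Y : nspaceType N)
    (j : forall n, X n -> Y) : Prop :=
  [/\ forall n, nmap (j n), forall n, j n.+1 \o i n =1 j n &
    forall (Z : nspaceType N) (u : forall n, X n -> Z),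
      (forall n, nmap (u n)) -> (forall n, u n.+1 \o i n =1 u n) ->
      exists! h : Y -> Z, nmap h /\ forall n, h \o j n =1 u n].

End NSpaces.

Section Balls.
Context (R : realType) (n : nat).
Definition eball : set 'rV[R]_n := [set x | \sum_i x 0 i ^+ 2 <= 1].
Definition esphere : set 'rV[R]_n := [set x | \sum_i x 0 i ^+ 2 = 1].
Fact sub_esphere_eball : esphere `<=` eball.
Proof. by move=> x; rewrite /esphere /eball /= => ->. Qed.
Definition esphere_incl (x : esphere) : eball :=
  exist _ (val x) (mem_set (sub_esphere_eball (set_valP x))).
End Balls.
Arguments eball : clear implicits.
Arguments esphere : clear implicits.

(** [eball R n.+1] and [esphere R n.+1] are B^(n+1) and S^n. The inclusions
    X_n -> X_(n+1) are the structural maps [cw_incl n] of the pushouts, and X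
    is their colimit. *)
Record projective_cw (R : realType) (N : monoidType) (X : nspaceType N) :=
  ProjectiveCW {
    cw_cell : nat -> nsetType N;
    cw_cell_projective : forall n, nset_projective (cw_cell n);
    cw_skel : nat -> nspaceType N;
    cw_skel0 : discrete_topology (cw_cell 0) -> cw_skel 0;
    cw_skel0_iso : is_nspace_iso cw_skel0;
    cw_attach : forall n,
      cells (cw_cell n.+1) (esphere R n.+1) -> cw_skel n;
    cw_attach_nmap : forall n, nmap (@cw_attach n);
    cw_incl : forall n, cw_skel n -> cw_skel n.+1;
    cw_char : forall n,
      cells (cw_cell n.+1) (eball R n.+1) -> cw_skel n.+1;
    cw_pushout : forall n,
      is_nspace_pushout (cells_map (@esphere_incl R n.+1)) (@cw_attach n)
        (@cw_incl n) (@cw_char n);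
    cw_skel_incl : forall n, cw_skel n -> X;
    cw_colim : is_nspace_colim cw_incl cw_skel_incl
  }.

Definition unit_interval (R : realType) : Type := `[0 : R, 1]%classic.

Section UnitInterval.
Context (R : realType).
HB.instance Definition _ := Topological.on (unit_interval R).
Fact itv0P : (0 : R) \in `[0 : R, 1]%classic.
Proof. by rewrite inE /= in_itv /= lexx ler01. Qed.
Fact itv1P : (1 : R) \in `[0 : R, 1]%classic.
Proof. by rewrite inE /= in_itv /= lexx ler01. Qed.
Definition itv0 : unit_interval R := exist _ 0 itv0P.
Definition itv1 : unit_interval R := exist _ 1 itv1P.
Fact itv01_neq : itv0 != itv1.
Proof. by apply/eqP => /(congr1 val) /= /eqP; rewrite eq_sym oner_eq0. Qed.
HB.instance Definition _ := isBiPointed.Build (unit_interval R) itv01_neq.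
End UnitInterval.

Section PathComponents.
Context (R : realType) (X : topologicalType).

Definition path_related : rel X :=
  fun x y => `[< inhabited {path (unit_interval R) from x to y in X} >].

Let clamp_mem (t : R) : Num.max 0 (Num.min t 1) \in `[0 : R, 1]%classic.
Proof.
by rewrite inE /= in_itv /= le_max lexx /= ge_max ler01 ge_min lexx orbT.
Qed.
Let clamp (t : R) : unit_interval R :=
  exist (fun x : R => x \in `[0 : R, 1]%classic) _ (clamp_mem t).

Let clamp_continuous : continuous clamp.
Proof.
apply: (@continuous_comp_initial (unit_interval R) R R set_val) => t.
apply: (@continuous_max _ R (cst 0) (fun t => Num.min t 1)); first exact: cvg_cst.
by apply: (@continuous_min _ R id (cst 1)); [exact: cvg_id|exact: cvg_cst].
Qed.

Let clamp_le0 (t : R) : t <= 0 -> clamp t = itv0 R.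
Proof.
move=> t0; apply: val_inj => /=.
by rewrite min_l ?(le_trans t0)// max_l.
Qed.

Let clamp_ge1 t : 1 <= t -> clamp t = itv1 R.
Proof. by move=> t1; apply: val_inj => /=; rewrite min_r// max_r. Qed.

Let path_of_real (f : R -> X) :
  continuous f -> path_related (f 0) (f 1).
Proof.
move=> cf; apply/asboolP; constructor.
pose g (t : unit_interval R) := f (set_val t).
have cg : continuous g.
  move=> t; apply: (@continuous_comp _ _ _ set_val f); last exact: cf.
  exact: initial_continuous.
exact: (@mk_path (unit_interval R) X (f 0) (f 1) g cg erefl erefl).
Qed.

Let real_of_path x y : path_related x y -> exists f : R -> X,
  [/\ continuous f, forall t : R, t <= 0 -> f t = x & forall t, 1 <= t -> f t = y].
Proof.
move=> /asboolP[p]; exists (p \o clamp); split.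
- move=> t; apply: continuous_comp; first exact: clamp_continuous.
  exact: cts_fun.
- by move=> t t0; rewrite /= clamp_le0//; exact: path_zero.
- by move=> t t1; rewrite /= clamp_ge1//; exact: path_one.
Qed.

Fact path_related_refl : reflexive path_related.
Proof. by move=> x; apply: (@path_of_real (cst x)) => t; exact: cvg_cst. Qed.

Let path_related_symW x y : path_related x y -> path_related y x.
Proof.
move=> /real_of_path[f [cf f0 f1]].
have : path_related (f (1 - 0)) (f (1 - 1)).
  apply: (@path_of_real (fun t => f (1 - t))) => t.
  apply: (@continuous_comp _ _ _ (fun t : R => 1 - t) f); last exact: cf.
  by apply: cvgB; [exact: cvg_cst|exact: cvg_id].
by rewrite subr0 subrr (f0 0)// (f1 1).
Qed.

Fact path_related_sym : symmetric path_related.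
Proof. by move=> x y; apply/idP/idP; exact: path_related_symW. Qed.

Fact path_related_trans : transitive path_related.
Proof.
move=> y x z /real_of_path[f [cf f0 f1]] /real_of_path[g [cg g0 g1]].
pose h (t : R) := if t <= 1 then f t else g (t - 1).
have ch : continuous h.
  apply/continuous_subspace_setT.
  have -> : [set: R] = [set t | t <= 1] `|` [set t | 1 <= t].
    by apply/seteqP; split => // t _; apply/orP; exact: le_total.
  apply: withinU_continuous; [exact: closed_le|exact: closed_ge| |].
  - apply: (@subspace_eq_continuous _ _ _ f).
      by move=> t; rewrite inE /= => t1; rewrite /from_subspace /h t1.
    exact: continuous_subspaceT.
  - pose g' (t : R) := g (t - 1).
    apply: (@subspace_eq_continuous _ _ _ g').
      move=> t; rewrite inE /= => t1; rewrite /from_subspace /h /g'.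
      case: ifPn => // t1'.
      have -> : t = 1 by apply/eqP; rewrite eq_le t1 t1'.
      by rewrite subrr (g0 0)// (f1 1).
    apply: continuous_subspaceT => t.
    apply: (@continuous_comp _ _ _ (fun t : R => t - 1) g); last exact: cg.
    by apply: cvgB; [exact: cvg_id|exact: cvg_cst].
have : path_related (h (2 * 0)) (h (2 * 1)).
  apply: (@path_of_real (fun t => h (2 * t))) => t.
  apply: (@continuous_comp _ _ _ (fun t : R => 2 * t) h); last exact: ch.
  by apply: cvgM; [exact: cvg_cst|exact: cvg_id].
have h2 : (2 <= 1 :> R) = false by apply/negbTE; rewrite -ltNge ltr1n.
rewrite mulr0 mulr1 /h ler01 h2 (f0 0)// g1//.
by rewrite lerBrDr.
Qed.

Definition path_equiv :=
  EquivRel path_related path_related_refl path_related_sym path_related_trans.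

Definition path_component (x : X) : set X := [set y | path_related x y].
End PathComponents.

Arguments path_component : clear implicits.

(** [pi0 R X] is the set of path components of X; R is the field of reals in
    which paths are parametrized. *)
Definition pi0 (R : realType) (X : topologicalType) : Type :=
  {eq_quot path_equiv R X}.

Section Pi0.
Context (R : realType) (N : monoidType) (X : nspaceType N).

Fact path_related_act (a : N) (x y : X) :
  path_equiv R X x y -> path_equiv R X (nact a x) (nact a y).
Proof.
move=> /asboolP[p]; apply/asboolP; constructor.
have ca : continuous (nact a : X -> X).
  move=> u W /= Wu.
  have [[U V] /= [Ua Vu] UVW] := @nact_continuous N X (a, u) W Wu.
  apply: filterS Vu => v Vv; apply: (UVW (a, v)); split => //=.
  by move: Ua; rewrite nbhs_principalE => /principal_filterP.
have cap : continuous (nact a \o p).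
  by move=> t; apply: continuous_comp; [exact: cts_fun|exact: ca].
by apply: (mk_path cap); rewrite /= ?path_zero ?path_one.
Qed.

HB.instance Definition _ := Choice.on (pi0 R X).
HB.instance Definition _ := isNSet.Build N (pi0 R X)
  (quot_nact1 path_related_act) (quot_nactM path_related_act).
End Pi0.

Definition contractible (R : realType) (T : topologicalType) : Prop :=
  exists (x0 : T) (H : unit_interval R * T -> T),
    [/\ continuous H, forall x, H (zero, x) = x & forall x, H (one, x) = x0].

Definition bi_classifying (R : realType) (M : monoidType)
    (X : nspaceType (bimonoid M)) : Prop :=
  (exists f : pi0 R X -> biset M, is_nset_iso f) /\
  forall x : X, contractible R (path_component R X x).

Definition bi_F (R : realType) (n : nat) (M : monoidType) : Prop :=
  exists (X : nspaceType (bimonoid M)) (C : projective_cw R X),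
    bi_classifying R X /\ forall i, (i <= n)%N -> nset_fg (cw_cell C i).

(** ZM. The algebra [{malg int[M]}] of multinomials is not available here: its
    monomials must have no units other than 1. *)
Definition monoid_ring (M : choiceType) : Type := {fsfun M -> int with 0}.

Section MonoidRingZmodule.
Context (M : choiceType).
HB.instance Definition _ := Choice.on (monoid_ring M).
Implicit Types f g h : monoid_ring M.

Definition mrsupp f : {fset M} := finsupp f.
Definition mrcoef (m : M) f : int := (f : {fsfun M -> int with 0}) m.

Lemma mrP f g : (forall m, mrcoef m f = mrcoef m g) -> f = g.
Proof. by move=> fg; apply/fsfunP. Qed.

Lemma mrcoef_out f m : m \notin mrsupp f -> mrcoef m f = 0.
Proof. exact: fsfun_dflt. Qed.

Definition mr_zero : monoid_ring M := [fsfun].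
Definition mr_opp f : monoid_ring M :=
  [fsfun m in mrsupp f => - mrcoef m f].
Definition mr_add f g : monoid_ring M :=
  [fsfun m in (mrsupp f `|` mrsupp g)%fset => mrcoef m f + mrcoef m g].

Fact mr_zeroE m : mrcoef m mr_zero = 0.
Proof. by rewrite /mrcoef fsfun0E. Qed.
Fact mr_oppE f m : mrcoef m (mr_opp f) = - mrcoef m f.
Proof.
by rewrite {1}/mrcoef fsfun_fun; case: ifPn => // /mrcoef_out ->; rewrite oppr0.
Qed.
Fact mr_addE f g m : mrcoef m (mr_add f g) = mrcoef m f + mrcoef m g.
Proof.
rewrite {1}/mrcoef fsfun_fun in_fsetU; case: ifPn => //.
by rewrite negb_or => /andP[/mrcoef_out -> /mrcoef_out ->]; rewrite addr0.
Qed.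

Fact mr_addA : associative mr_add.
Proof. by move=> f g h; apply: mrP => m; rewrite !mr_addE addrA. Qed.
Fact mr_addC : commutative mr_add.
Proof. by move=> f g; apply: mrP => m; rewrite !mr_addE addrC. Qed.
Fact mr_add0 : left_id mr_zero mr_add.
Proof. by move=> f; apply: mrP => m; rewrite mr_addE mr_zeroE add0r. Qed.
Fact mr_addN : left_inverse mr_zero mr_opp mr_add.
Proof.
by move=> f; apply: mrP => m; rewrite mr_addE mr_oppE mr_zeroE addNr.
Qed.

HB.instance Definition _ := GRing.isZmodule.Build (monoid_ring M)
  mr_addA mr_addC mr_add0 mr_addN.

Fact mrcoef_zmod_morphism m : zmod_morphism (mrcoef m).
Proof. by move=> f g; rewrite mr_addE mr_oppE. Qed.
HB.instance Definition _ m := GRing.isZmodMorphism.Build (monoid_ring M) int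
  (mrcoef m) (mrcoef_zmod_morphism m).

Definition mrmon (m : M) (c : int) : monoid_ring M :=
  [fsfun x in [fset m]%fset => c].

Fact mrmonE m c x : mrcoef x (mrmon m c) = c *+ (x == m).
Proof. by rewrite /mrcoef fsfun_fun in_fset1; case: eqP. Qed.

Fact mrmon_zmod_morphism m : zmod_morphism (mrmon m).
Proof.
by move=> b c; apply: mrP => x; rewrite raddfB /= !mrmonE mulrnBl.
Qed.
HB.instance Definition _ m := GRing.isZmodMorphism.Build int (monoid_ring M)
  (mrmon m) (mrmon_zmod_morphism m).

Lemma mrE f : f = \sum_(m <- mrsupp f) mrmon m (mrcoef m f).
Proof.
apply: mrP => x; rewrite raddf_sum /=.
under eq_bigr do rewrite mrmonE.
have [xf|xf] := boolP (x \in mrsupp f); last first.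
  rewrite mrcoef_out// big_seq big1// => m mf.
  by case: eqP => [xm|//]; rewrite xm mf in xf.
rewrite (big_fsetD1 x)//= eqxx mulr1n big_seq big1 ?addr0// => m.
by rewrite in_fsetD1 eq_sym => /andP[/negbTE ->].
Qed.

End MonoidRingZmodule.

Section MonoidRingMul.
Context (M : monoidType).
Implicit Types f g h : monoid_ring M.

Definition mr_mul f g : monoid_ring M :=
  \sum_(a <- mrsupp f) \sum_(b <- mrsupp g)
    mrmon (a * b)%g (mrcoef a f * mrcoef b g).

Fact mr_mulw (A B : {fset M}) f g :
  (mrsupp f `<=` A)%fset -> (mrsupp g `<=` B)%fset ->
  mr_mul f g = \sum_(a <- A) \sum_(b <- B)
    mrmon (a * b)%g (mrcoef a f * mrcoef b g).
Proof.
move=> fA gB; rewrite /mr_mul (big_fset_incl _ fA) /=; last first.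
  move=> a _ /mrcoef_out fa.
  by rewrite big1 // => b _; rewrite fa mul0r raddf0.
apply: eq_bigr => a _; apply: big_fset_incl => // b _ /mrcoef_out ->.
by rewrite mulr0 raddf0.
Qed.

Fact mrsupp_add f g : (mrsupp (f + g)%R `<=` mrsupp f `|` mrsupp g)%fset.
Proof.
apply/fsubsetP => m; apply: contraLR; rewrite in_fsetU negb_or.
move=> /andP[/mrcoef_out fm /mrcoef_out gm]; rewrite memNfinsupp.
by have /eqP := mr_addE f g m; rewrite fm gm addr0.
Qed.

Fact mr_mulDl : left_distributive mr_mul +%R.
Proof.
move=> f g h; pose A := (mrsupp f `|` mrsupp g)%fset.
rewrite (@mr_mulw A (mrsupp h) (f + g) h)// ?mrsupp_add//.
rewrite (@mr_mulw A (mrsupp h) f h) ?fsubsetUl//.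
rewrite (@mr_mulw A (mrsupp h) g h) ?fsubsetUr//.
rewrite -big_split; apply: eq_bigr => a _ /=.
by rewrite -big_split; apply: eq_bigr => b _ /=; rewrite raddfD mulrDl raddfD.
Qed.

Fact mr_mulDr : right_distributive mr_mul +%R.
Proof.
move=> h f g; pose A := (mrsupp f `|` mrsupp g)%fset.
rewrite (@mr_mulw (mrsupp h) A h (f + g))// ?mrsupp_add//.
rewrite (@mr_mulw (mrsupp h) A h f) ?fsubsetUl//.
rewrite (@mr_mulw (mrsupp h) A h g) ?fsubsetUr//.
rewrite -big_split; apply: eq_bigr => a _ /=.
by rewrite -big_split; apply: eq_bigr => b _ /=; rewrite raddfD mulrDr raddfD.
Qed.

Fact mrsupp_mon a c : (mrsupp (mrmon a c) `<=` [fset (a : M)])%fset.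
Proof.
apply/fsubsetP => m; apply: contraLR; rewrite in_fset1 => ma.
by rewrite memNfinsupp; have /eqP := mrmonE a c m; rewrite (negbTE ma).
Qed.

Lemma mr_mulUU a b c d :
  mr_mul (mrmon a c) (mrmon b d) = mrmon (a * b)%g (c * d).
Proof.
rewrite (mr_mulw (mrsupp_mon a c) (mrsupp_mon b d)) !big_seq_fset1.
by rewrite !mrmonE !eqxx.
Qed.

Fact mr_mul0l : left_zero 0 mr_mul.
Proof. by move=> g; apply: (addrI (mr_mul 0 g)); rewrite -mr_mulDl !addr0. Qed.
Fact mr_mul0r : right_zero 0 mr_mul.
Proof. by move=> g; apply: (addrI (mr_mul g 0)); rewrite -mr_mulDr !addr0. Qed.

Let mull_sum g (I : Type) (r : seq I) (F : I -> monoid_ring M) :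
  mr_mul (\sum_(i <- r) F i) g = \sum_(i <- r) mr_mul (F i) g.
Proof.
exact: (big_morph (mr_mul^~ g) (fun x y => mr_mulDl x y g) (mr_mul0l g)).
Qed.
Let mulr_sum g (I : Type) (r : seq I) (F : I -> monoid_ring M) :
  mr_mul g (\sum_(i <- r) F i) = \sum_(i <- r) mr_mul g (F i).
Proof. exact: (big_morph (mr_mul g) (mr_mulDr g) (mr_mul0r g)). Qed.

Fact mr_mulA : associative mr_mul.
Proof.
move=> f g h; rewrite (mrE f) (mrE g) (mrE h).
rewrite !mull_sum; apply: eq_bigr => a _.
rewrite mulr_sum [X in _ = mr_mul X _]mulr_sum mull_sum.
apply: eq_bigr => b _.
rewrite !mulr_sum; apply: eq_bigr => c _.
by rewrite !mr_mulUU mulrA mulgA.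
Qed.

Fact mr_mul1l : left_id (mrmon 1%g 1) mr_mul.
Proof.
move=> f; rewrite {1}(mrE f) mulr_sum [RHS]mrE; apply: eq_bigr => a _.
by rewrite mr_mulUU mul1g mul1r.
Qed.
Fact mr_mul1r : right_id (mrmon 1%g 1) mr_mul.
Proof.
move=> f; rewrite {1}(mrE f) mull_sum [RHS]mrE; apply: eq_bigr => a _.
by rewrite mr_mulUU mulg1 mulr1.
Qed.
Fact mr_1neq0 : mrmon 1%g 1 != 0 :> monoid_ring M.
Proof.
by apply/eqP => /(congr1 (mrcoef 1%g)); rewrite mrmonE eqxx raddf0.
Qed.

HB.instance Definition _ := GRing.Zmodule_isNzRing.Build (monoid_ring M)
  mr_mulA mr_mul1l mr_mul1r mr_mulDl mr_mulDr mr_1neq0.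

End MonoidRingMul.

HB.mixin Record Lmodule_isBimodule (R S : pzRingType) V & GRing.Lmodule R V := {
  rscale : V -> S -> V;
  rscaleA : forall v a b, rscale (rscale v a) b = rscale v (a * b);
  rscaler1 : forall v, rscale v 1 = v;
  rscalerDl : forall u v a, rscale (u + v) a = rscale u a + rscale v a;
  rscalerDr : forall v a b, rscale v (a + b) = rscale v a + rscale v b;
  rscaleZ : forall (a : R) v b, rscale (a *: v) b = a *: rscale v b
}.

#[short(type="bimodType")]
HB.structure Definition Bimodule (R S : pzRingType) :=
  {V of GRing.Lmodule R V & Lmodule_isBimodule R S V}.

Section RegularBimodule.
Context (R : pzRingType).
Let rmul (v : R^o) (a : R) : R^o := (v : R) * a.
Fact regular_rscaleA v a b : rmul (rmul v a) b = rmul v (a * b).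
Proof. by rewrite /rmul mulrA. Qed.
Fact regular_rscaler1 v : rmul v 1 = v.
Proof. exact: mulr1. Qed.
Fact regular_rscalerDl u v a : rmul (u + v) a = rmul u a + rmul v a.
Proof. exact: mulrDl. Qed.
Fact regular_rscalerDr v a b : rmul v (a + b) = rmul v a + rmul v b.
Proof. exact: mulrDr. Qed.
Fact regular_rscaleZ (a : R) v b : rmul (a *: v) b = a *: rmul v b.
Proof. by rewrite /rmul /GRing.scale /= mulrA. Qed.
HB.instance Definition _ := Lmodule_isBimodule.Build R R R^o
  regular_rscaleA regular_rscaler1 regular_rscalerDl regular_rscalerDr
  regular_rscaleZ.
End RegularBimodule.

Section Bimodules.
Context (R S : pzRingType).

Definition bimod_hom (U V : bimodType R S) (f : U -> V) : Prop :=
  linear f /\ forall u b, f (rscale u b) = rscale (f u) b.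

Definition bimod_projective (P : bimodType R S) : Prop :=
  forall (U V : bimodType R S) (f : U -> V) (g : P -> V),
    bimod_hom f -> bimod_hom g -> (forall v, exists u, f u = v) ->
    exists2 h : P -> U, bimod_hom h & f \o h =1 g.

Definition bimod_fg (V : bimodType R S) : Prop :=
  exists2 X : set V, finite_set X &
    forall v, exists2 t : seq (R * V * S), (forall u, u \in t -> X u.1.2) &
      v = \sum_(u <- t) rscale (u.1.1 *: u.1.2) u.2.

End Bimodules.

(** The resolution is indexed by [nat]; nothing is required of [A i] for i > n
    or of [d i] for i >= n. *)
Definition bi_FP (n : nat) (M : monoidType) : Prop :=
  let ZM := monoid_ring M in
  exists (A : nat -> bimodType ZM ZM) (d : forall i, A i.+1 -> A i)
         (eps : A 0 -> ZM^o),
    [/\ forall i, (i <= n)%N -> bimod_fg (A i) /\ bimod_projective (A i),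
        bimod_hom eps /\ (forall i, (i < n)%N -> bimod_hom (d i)),
        forall z, exists x, eps x = z,
        (0 < n)%N -> forall x, eps x = 0 <-> exists y, d 0%N y = x &
        forall i, (i.+1 < n)%N ->
          forall x, d i x = 0 <-> exists y, d i.+1 y = x].

(* Main.v *)
From HB Require Import structures.
Require Import Defs.
From mathcomp Require Import all_boot all_order all_algebra generic_quotient.
From mathcomp Require Import finmap ring lra.
From mathcomp Require Import all_classical reals topology normedtype.
From mathcomp Require Import realfun continuous_path.
From Stdlib Require Import Relation_Operators.

(** Write N for M x M^op. The N-set M is cyclic: it is the quotient of N by the
relation that identifies (a, b) with (c, d) when a b = c d. Each of the four
conditions says that this presentation of M is finite, seen in spaces, in
bimodules, in the two-sided Cayley digraph, or through homomorphisms out of M.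

The heart of the matter is that a pair of homomorphisms f, g : M -> K makes K
an N-set, by (a, b) k = f(a) k g(b), and that (a, b) |-> f(a) g(b) is an
equivariant map N -> K. This map factors through multiplication N -> M exactly
when f = g, and it sends (a, b) to g(a b) as soon as f and g agree at a.

- If M is of type bi-FP_1 or bi-F_1, lift the augmentation of the module or set
  of 0-cells along Z[N] -> ZM or N -> M, which is possible because this module
  or set is projective. The relations are then generated by finitely many
  elements, and if f and g agree at the finitely many left coordinates that
  occur in these elements, the map above respects all relations; hence f = g.
  This gives a finite dominating set ([bi_FP1_dominates], [bi_F1_dominates]). For spaces, the
  relations come from the 1-cells alone, because a locally constant map extends
  over every cell whose boundary sphere is connected ([cw_extend_discrete]).

- If A dominates M, let T be the set of components of the two-sided Cayley
  digraph and t the component of (1, 1). The homomorphisms m |-> (m, 0) and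
  m |-> (m, m t - t m) into the square-zero extension of M by Z[T] agree on A,
  since a in A gives an edge between (a, 1) and (1, a). So m t = t m for all m,
  and every vertex (a, b) is joined to (1, a b) ([dominates_pi0_iso]).

- If the components of the digraph are the fibres of multiplication, then its
  augmented cellular chain complex is exact at the vertices, which is a
  resolution as required by bi-FP_1 ([pi0_iso_bi_FP1]). For bi-F_1, start from
  the digraph as a 1-dimensional complex and, for n >= 1, attach one free
  orbit of (n+1)-cells for every map of S^n to the n-skeleton. The components
  of the result X are contractible: a homotopy from the inclusion of the
  n-skeleton to the map that sends each point to the vertex (1, m) of its
  component is built skeleton by skeleton, with values one dimension higher.
  Over a cell B x [0, 1] it is prescribed on the boundary, a sphere, and this
  sphere has been filled ([pi0_iso_bi_F1]). *)

Set Implicit Arguments.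
Unset Strict Implicit.
Unset Printing Implicit Defensive.

Import Order.TTheory GRing.Theory Num.Theory.
Import numFieldNormedType.Exports.

Local Open Scope classical_set_scope.
Local Open Scope ring_scope.
Local Open Scope quotient_scope.

(** * Free and twisted sets over a monoid *)

Definition free_nset (N I : Type) : Type := (N * I)%type.

Section FreeNSet.
Context (N : monoidType) (I : choiceType).
HB.instance Definition _ := Choice.on (free_nset N I).
Definition free_act (a : N) (x : free_nset N I) : free_nset N I :=
  ((a * x.1)%g, x.2).
Fact free_act1 x : free_act 1%g x = x.
Proof. by case: x => a i; rewrite /free_act mul1g. Qed.
Fact free_actM a b x : free_act (a * b)%g x = free_act a (free_act b x).
Proof. by rewrite /free_act mulgA. Qed.
HB.instance Definition _ :=
  isNSet.Build N (free_nset N I) free_act1 free_actM.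

Lemma free_nset_lift (Q : nsetType N) (q : I -> Q) :
  equivariant (fun x : free_nset N I => nact x.1 (q x.2)).
Proof. by move=> a [b i] /=; rewrite nactM. Qed.

(** Send the generator (1, i) to a preimage of it. *)
Lemma free_nset_projective : nset_projective (free_nset N I).
Proof.
move=> Q f fe fs.
pose q i := sval (cid (fs (1%g, i))).
exists (fun x : free_nset N I => nact x.1 (q x.2)).
  exact: free_nset_lift.
move=> [a i] /=; rewrite fe /q; case: cid => y /= ->.
by rewrite /nact /= /free_act mulg1.
Qed.

Lemma free_nset_fg : finite_set [set: I] -> nset_fg (free_nset N I).
Proof.
move=> fI; exists [set (1%g : N, i) | i in [set: I]]; first exact: finite_image.
move=> [a i]; exists a, (1%g, i); first by exists i.
by rewrite /nact /= /free_act mulg1.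
Qed.
End FreeNSet.

Section Twist.
Context (M K : monoidType) (f g : UMagmaMorphism.type M K).
(** For N = M x M^op, the map (a, b) |-> f(a) g(b) is equivariant from N to this N-set;
it factors through M exactly when f = g. *)
Definition twisted of M -> K & M -> K : Type := K.
Let T := twisted f g.
HB.instance Definition _ := Choice.on T.
Definition twisted_act (a : bimonoid M) (x : T) : T :=
  (f a.1 * (x : K) * g a.2)%g.
Fact twisted_act1 x : twisted_act 1%g x = x.
Proof. by rewrite /twisted_act gmulf1 mul1g; rewrite [g _]gmulf1 mulg1. Qed.
Fact twisted_actM a b x : twisted_act (a * b)%g x = twisted_act a (twisted_act b x).
Proof. by rewrite /twisted_act /= !gmulfM !mulgA. Qed.
HB.instance Definition _ :=
  isNSet.Build (bimonoid M) T twisted_act1 twisted_actM.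
End Twist.

(** * The bimodule spanned by a biset *)

Section Lift.
Context (T : choiceType).

(** Addition and integer multiples are reached from subtraction, so that the
predicates met below, equalizers of additive maps, need one closure property. *)
Lemma mr_ind (P : monoid_ring T -> Prop) :
  P 0 -> (forall x y, P x -> P y -> P (x - y)) ->
  (forall t, P (mrmon t 1)) -> forall x, P x.
Proof.
move=> P0 PB Pm x.
have PN y : P y -> P (- y) by move=> /(PB _ _ P0); rewrite sub0r.
have PD y z : P y -> P z -> P (y + z).
  by move=> Py /PN /(PB _ _ Py); rewrite opprK.
rewrite (mrE x); apply: (big_ind P) => // t _.
have Pn n : P (mrmon t n%:Z).
  elim: n => [|n ih]; first by rewrite raddf0.
  by rewrite intS raddfD; exact: (PD _ _ (Pm t) ih).
case: (mrcoef t x) => n; first exact: Pn.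
by rewrite NegzE raddfN; exact: (PN _ (Pn n.+1)).
Qed.

Definition mrlift (V : zmodType) (F : T -> V) (x : monoid_ring T) : V :=
  \sum_(t <- mrsupp x) F t *~ mrcoef t x.

Section LiftV.
Context (V : zmodType) (F : T -> V).

Lemma mrlift_sub (A : {fset T}) x : (mrsupp x `<=` A)%fset ->
  mrlift F x = \sum_(t <- A) F t *~ mrcoef t x.
Proof.
move=> xA; apply: big_fset_incl => // t _ /mrcoef_out ->.
by rewrite mulr0z.
Qed.

Fact mrlift_zmod_morphism : zmod_morphism (mrlift F).
Proof.
move=> x y; pose A := (mrsupp x `|` mrsupp y `|` mrsupp (x - y))%fset.
rewrite !(@mrlift_sub A) ?fsubsetUr//.
- rewrite -sumrB; apply: eq_bigr => t _.
  by rewrite raddfB mulrzBr.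
- by rewrite /A fsubsetU// fsubsetUr.
- by rewrite /A fsubsetU// fsubsetUl.
Qed.
HB.instance Definition _ :=
  GRing.isZmodMorphism.Build (monoid_ring T) V (mrlift F) mrlift_zmod_morphism.

Lemma mrlift_mon t c : mrlift F (mrmon t c) = F t *~ c.
Proof.
rewrite (@mrlift_sub [fset t]%fset).
  by rewrite big_seq_fset1 mrmonE eqxx.
apply/fsubsetP => m; apply: contraLR; rewrite in_fset1 => ma.
by rewrite memNfinsupp; have /eqP := mrmonE t c m; rewrite (negbTE ma).
Qed.
End LiftV.

(** Only the support counts: this is how agreement of two homomorphisms at finitely
many elements is put to use. *)
Lemma mrlift_eq (V : zmodType) (F G : T -> V) x :
  (forall t, t \in mrsupp x -> F t = G t) -> mrlift F x = mrlift G x.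
Proof. by move=> FG; apply: eq_big_seq => t /FG ->. Qed.

Lemma mr_additive_ext (V : zmodType) (u v : monoid_ring T -> V) :
  zmod_morphism u -> zmod_morphism v ->
  (forall t, u (mrmon t 1) = v (mrmon t 1)) -> u =1 v.
Proof.
move=> ua va uv; apply: mr_ind => //.
- by rewrite -(subrr 0) ua va !subrr.
- by move=> x y ux uy; rewrite ua va ux uy.
Qed.

End Lift.

Section Bispan.
Context (M : monoidType).
Notation ZM := (monoid_ring M).

(** A second name for [monoid_ring T], so that the bimodule structure coming from
an action on T does not compete with the multiplication of a monoid ring. *)
Definition bispan (T : choiceType) : Type := monoid_ring T.
HB.instance Definition _ (T : choiceType) := GRing.Zmodule.on (bispan T).

Lemma mrlift_subfun (T : choiceType) (V : zmodType) (F G : T -> V) x :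
  mrlift (fun t => F t - G t) x = mrlift F x - mrlift G x.
Proof. by rewrite -sumrB; apply: eq_bigr => t _; rewrite mulrzBl. Qed.

Section Structure.
Context (T : nsetType (bimonoid M)).
Implicit Types (x y : bispan T) (a b : ZM).

(** The additive endomorphism of Z[T] induced by the action of n. *)
Definition push (n : bimonoid M) x : bispan T :=
  mrlift (fun t => mrmon (nact n t) 1) x.

Fact push_zmod_morphism n : zmod_morphism (push n).
Proof. exact: mrlift_zmod_morphism. Qed.
HB.instance Definition _ n :=
  GRing.isZmodMorphism.Build (bispan T) (bispan T) (push n) (push_zmod_morphism n).

Lemma push0 n : push n 0 = 0.
Proof. exact: raddf0. Qed.
Lemma pushB n x y : push n (x - y) = push n x - push n y.
Proof. exact: raddfB. Qed.
Lemma pushD n x y : push n (x + y) = push n x + push n y.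
Proof. exact: raddfD. Qed.

Lemma push_mon n t : push n (mrmon t 1) = mrmon (nact n t) 1.
Proof. by rewrite /push mrlift_mon. Qed.

Lemma push1 x : push 1%g x = x.
Proof.
move: x; apply: mr_additive_ext => // [|t]; first exact: push_zmod_morphism.
by rewrite push_mon nact1.
Qed.

Lemma pushM m n x : push (m * n)%g x = push m (push n x).
Proof.
move: x; apply: mr_additive_ext => [|x y|t]; first exact: push_zmod_morphism.
  by rewrite !raddfB.
by rewrite !push_mon nactM.
Qed.

Definition bispan_lscale a x : bispan T :=
  mrlift (fun m => push ((m, 1%g) : bimonoid M) x) a.
Definition bispan_rscale x b : bispan T :=
  mrlift (fun m => push ((1%g, m) : bimonoid M) x) b.

Fact bispan_lscaleBl x : zmod_morphism (bispan_lscale^~ x).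
Proof. exact: mrlift_zmod_morphism. Qed.
Fact bispan_lscaleBr a : zmod_morphism (bispan_lscale a).
Proof.
move=> x y; rewrite /bispan_lscale -mrlift_subfun.
by apply: mrlift_eq => m _; rewrite raddfB.
Qed.
Fact bispan_rscaleBr x : zmod_morphism (bispan_rscale x).
Proof. exact: mrlift_zmod_morphism. Qed.
Fact bispan_rscaleBl a : zmod_morphism (bispan_rscale^~ a).
Proof.
move=> x y; rewrite /bispan_rscale -mrlift_subfun.
by apply: mrlift_eq => m _; rewrite raddfB.
Qed.

Lemma bispan_lscale_mon m x :
  bispan_lscale (mrmon m 1) x = push ((m, 1%g) : bimonoid M) x.
Proof. by rewrite /bispan_lscale mrlift_mon. Qed.
Lemma bispan_rscale_mon m x :
  bispan_rscale x (mrmon m 1) = push ((1%g, m) : bimonoid M) x.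
Proof. by rewrite /bispan_rscale mrlift_mon. Qed.

Lemma mr_mon_mul m n : mrmon m 1 * mrmon n 1 = mrmon (m * n)%g 1 :> ZM.
Proof. exact: mr_mulUU. Qed.

Fact bispan_lscaleA a b x :
  bispan_lscale a (bispan_lscale b x) = bispan_lscale (a * b) x.
Proof.
move: a; apply: mr_additive_ext => [a b'|a b'|m].
- exact: bispan_lscaleBl.
- by rewrite mulrBl bispan_lscaleBl.
move: b; apply: mr_additive_ext => [a b'|a b'|n].
- by rewrite bispan_lscaleBl bispan_lscaleBr.
- by rewrite mulrBr bispan_lscaleBl.
rewrite mr_mon_mul !bispan_lscale_mon -pushM.
by congr push; congr pair; rewrite /= mulg1.
Qed.
Fact bispan_lscale1 : left_id 1 bispan_lscale.
Proof. by move=> x; rewrite [LHS]bispan_lscale_mon push1. Qed.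
Fact bispan_lscaleDr : right_distributive bispan_lscale +%R.
Proof.
by move=> a x y; rewrite -[y in LHS]opprK bispan_lscaleBr -[- y]sub0r
  bispan_lscaleBr -[0 in X in _ - X]subr0 bispan_lscaleBr opprB !subrr subr0.
Qed.
Fact bispan_lscaleDl x : {morph bispan_lscale^~ x : a b / a + b}.
Proof. exact: raddfD. Qed.

HB.instance Definition _ := GRing.Zmodule_isLmodule.Build ZM (bispan T)
  bispan_lscaleA bispan_lscale1 bispan_lscaleDr bispan_lscaleDl.

Fact bispan_rscaleA x a b :
  bispan_rscale (bispan_rscale x a) b = bispan_rscale x (a * b).
Proof.
move: a; apply: mr_additive_ext => [a b'|a b'|m].
- by rewrite bispan_rscaleBr bispan_rscaleBl.
- by rewrite mulrBl bispan_rscaleBr.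
move: b; apply: mr_additive_ext => [a b'|a b'|n].
- exact: bispan_rscaleBr.
- by rewrite mulrBr bispan_rscaleBr.
rewrite mr_mon_mul !bispan_rscale_mon -pushM.
by congr push; congr pair; rewrite /= mulg1.
Qed.
Fact bispan_rscale1 x : bispan_rscale x 1 = x.
Proof. by rewrite [LHS]bispan_rscale_mon push1. Qed.
Fact bispan_rscaleDl x y a :
  bispan_rscale (x + y) a = bispan_rscale x a + bispan_rscale y a.
Proof.
by rewrite -[y in LHS]opprK bispan_rscaleBl -[- y]sub0r
  bispan_rscaleBl -[0 in X in _ - X]subr0 bispan_rscaleBl opprB !subrr subr0.
Qed.
Fact bispan_rscaleDr x a b :
  bispan_rscale x (a + b) = bispan_rscale x a + bispan_rscale x b.
Proof. exact: (raddfD (mrlift _)). Qed.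
Fact bispan_rscaleZ a x b :
  bispan_rscale (a *: x) b = a *: bispan_rscale x b.
Proof.
rewrite /GRing.scale /=; move: a; apply: mr_additive_ext => [a b'|a b'|m].
- by rewrite bispan_lscaleBl bispan_rscaleBl.
- exact: bispan_lscaleBl.
move: b; apply: mr_additive_ext => [a b'|a b'|n].
- exact: bispan_rscaleBr.
- by rewrite bispan_rscaleBr bispan_lscaleBr.
rewrite !(bispan_rscale_mon, bispan_lscale_mon) -!pushM.
by congr push; congr pair; rewrite /= ?mulg1 ?mul1g.
Qed.
HB.instance Definition _ := Lmodule_isBimodule.Build ZM ZM (bispan T)
  bispan_rscaleA bispan_rscale1 bispan_rscaleDl bispan_rscaleDr bispan_rscaleZ.

End Structure.
End Bispan.

(** * Free bimodules *)

Section BimodAction.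
Context (M : monoidType).
Notation ZM := (monoid_ring M).

(** A bimodule is in particular an N-set, for N = M x M^op; bimodule maps out of
Z[T] are the same as equivariant maps out of T ([mrlift_bimod_hom]). *)
Definition bimod_act (V : bimodType ZM ZM) (n : bimonoid M) (v : V) : V :=
  rscale (mrmon (n.1 : M) 1 *: v) (mrmon (n.2 : M) 1).

Section Hom.
Context (U V : bimodType ZM ZM) (f : U -> V) (fh : bimod_hom f).

Lemma bimod_hom_zmod : zmod_morphism f.
Proof.
move=> x y; case: fh => fl _.
by rewrite addrC -scaleN1r fl scaleN1r addrC.
Qed.

Lemma bimod_hom0 : f 0 = 0.
Proof. by rewrite -(subrr 0) bimod_hom_zmod subrr. Qed.

Lemma bimod_homZ a x : f (a *: x) = a *: f x.
Proof. by case: fh => fl _; rewrite -[a *: x]addr0 fl bimod_hom0 addr0. Qed.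

Lemma bimod_hom_act n x : f (bimod_act n x) = bimod_act n (f x).
Proof. by rewrite /bimod_act (proj2 fh) bimod_homZ. Qed.
End Hom.

Lemma bimod_hom_comp (U V W : bimodType ZM ZM) (f : U -> V) (g : V -> W) :
  bimod_hom f -> bimod_hom g -> bimod_hom (g \o f).
Proof.
move=> fh gh; split=> [a x y|x b] /=.
  by rewrite (proj1 fh) (proj1 gh).
by rewrite (proj2 fh) (proj2 gh).
Qed.

Section RScale.
Context (V : bimodType ZM ZM).
Lemma rscaleBl (u v : V) (a : ZM) : rscale (u - v) a = rscale u a - rscale v a.
Proof.
by apply: (addIr (rscale v a)); rewrite -rscalerDl !subrK.
Qed.
Lemma rscaleBr (u : V) (a b : ZM) : rscale u (a - b) = rscale u a - rscale u b.
Proof.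
by apply: (addIr (rscale u b)); rewrite -rscalerDr !subrK.
Qed.
Lemma bimod_actB n (u v : V) :
  bimod_act n (u - v) = bimod_act n u - bimod_act n v.
Proof. by rewrite /bimod_act scalerBr rscaleBl. Qed.
Lemma bimod_actM m n (v : V) :
  bimod_act (m * n)%g v = bimod_act m (bimod_act n v).
Proof.
by rewrite /bimod_act -rscaleZ rscaleA scalerA !mr_mon_mul.
Qed.
End RScale.

Lemma bispan_actE (T : nsetType (bimonoid M)) n t :
  bimod_act n (mrmon t 1 : bispan T) = mrmon (nact n t) 1.
Proof.
rewrite /bimod_act /GRing.scale /= [rscale _ _]bispan_rscale_mon.
rewrite bispan_lscale_mon !push_mon -nactM; congr (mrmon (nact _ _) _).
by case: n => m m'; congr pair; rewrite /= ?mul1g ?mulg1.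
Qed.

(** Both conditions are equalities of biadditive maps, hence need only be checked on
basis elements, where they are the equivariance of F. *)
Lemma mrlift_bimod_hom (T : nsetType (bimonoid M)) (V : bimodType ZM ZM)
    (F : T -> V) :
  (forall n t, F (nact n t) = bimod_act n (F t)) ->
  bimod_hom (mrlift F : bispan T -> V).
Proof.
move=> Fe.
have ZE : forall (a : ZM) (x : bispan T), mrlift F (a *: x) = a *: mrlift F x.
  move=> a x; move: a; apply: mr_additive_ext => [a b|a b|m].
  - by rewrite scalerBl raddfB.
  - exact: scalerBl.
  move: x; apply: mr_additive_ext => [x y|x y|t].
  - by rewrite scalerBr raddfB.
  - by rewrite raddfB scalerBr.
  rewrite {1}/GRing.scale /= bispan_lscale_mon push_mon !mrlift_mon !mulr1z Fe.
  by rewrite /bimod_act [LHS]rscaler1.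
split=> [a x y|x b]; first by rewrite raddfD; congr (_ + _); exact: ZE.
move: b; apply: mr_additive_ext => [a b|a b|m].
- by rewrite rscaleBr raddfB.
- exact: rscaleBr.
move: x; apply: mr_additive_ext => [x y|x y|t].
- by rewrite rscaleBl raddfB.
- by rewrite raddfB rscaleBl.
rewrite [rscale _ _]bispan_rscale_mon push_mon !mrlift_mon !mulr1z Fe.
by rewrite /bimod_act [_ *: _]scale1r.
Qed.

Lemma mrmon_intz (T : choiceType) (t : T) c : mrmon t c = mrmon t 1 *~ c.
Proof. by rewrite -raddfMz intz. Qed.

(** The integer coefficient of a basis element of Z[T] can be absorbed in the left
scalar; this is what turns a finite sum in Z[T] into a combination of
generators in the sense of [bimod_fg]. *)
Lemma bimod_act_intz (V : bimodType ZM ZM) (m m' : M) (c : int) (v : V) :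
  rscale (mrmon m 1 *~ c *: v) (mrmon m' 1) =
  bimod_act ((m, m') : bimonoid M) v *~ c.
Proof.
have za : zmod_morphism (fun z : int => rscale (mrmon m 1 *~ z *: v) (mrmon m' 1)).
  by move=> p q; rewrite mulrzBr scalerBl rscaleBl.
pose H := GRing.isZmodMorphism.Build _ _ _ za.
pose F : {additive int -> V} :=
  HB.pack (fun z : int => rscale (mrmon m 1 *~ z *: v) (mrmon m' 1)) H.
by rewrite -[c in LHS]intz [LHS](raddfMz F c 1).
Qed.

Lemma free_nact_one (I : choiceType) (n : bimonoid M) (i : I) :
  nact n ((1%g, i) : free_nset (bimonoid M) I) = (n, i).
Proof. by rewrite /nact /= /free_act /= mulg1. Qed.

Definition free_bimod (I : choiceType) : bimodType ZM ZM :=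
  bispan (free_nset (bimonoid M) I).

Lemma free_bimod_lift_hom (I : choiceType) (V : bimodType ZM ZM) (u : I -> V) :
  bimod_hom (mrlift (fun x : free_nset (bimonoid M) I => bimod_act x.1 (u x.2))
             : free_bimod I -> V).
Proof. by apply: mrlift_bimod_hom => n t /=; rewrite bimod_actM. Qed.

(** A bimodule map out of the span of a free N-set is determined by arbitrary values
at the generators; choose preimages there. *)
Lemma free_bimod_projective (I : choiceType) : bimod_projective (free_bimod I).
Proof.
move=> U V f g fh gh fs.
pose u i := sval (cid (fs (g (mrmon (1%g, i) 1)))).
exists (mrlift (fun x : free_nset (bimonoid M) I => bimod_act x.1 (u x.2))).
  exact: free_bimod_lift_hom.
apply: mr_additive_ext => [x y|x y|[n i]] /=.
- by rewrite raddfB (bimod_hom_zmod fh).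
- exact: (bimod_hom_zmod gh).
rewrite mrlift_mon mulr1z (bimod_hom_act fh) /u; case: cid => v /= ->.
rewrite -(bimod_hom_act gh) bispan_actE.
by rewrite free_nact_one.
Qed.

Lemma free_bimod_fg (I : choiceType) :
  finite_set [set: I] -> bimod_fg (free_bimod I).
Proof.
move=> fI; pose e i : free_bimod I := mrmon (1%g, i) 1.
exists [set e i | i in [set: I]]; first exact: finite_image.
move=> x; exists [seq (mrmon (t.1.1 : M) (mrcoef t x), e t.2, mrmon (t.1.2 : M) 1)
  | t <- mrsupp x].
  by move=> u /mapP[t _ ->] /=; exists t.2.
rewrite big_map [LHS]mrE; apply: eq_bigr => -[n i] _ /=.
rewrite (mrmon_intz n.1) bimod_act_intz bispan_actE free_nact_one.
by rewrite [LHS]mrmon_intz; case: n.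
Qed.

End BimodAction.

(** * From domination to the two-sided Cayley digraph *)

Lemma bimulE (M : monoidType) (a b c d : M) :
  (((a, b) : bimonoid M) * ((c, d) : bimonoid M))%g =
  ((a * c)%g, (d * b)%g) :> bimonoid M.
Proof. by []. Qed.

Section SquareZero.
Context (M : monoidType) (T : nsetType (bimonoid M)).

(** The monoid of matrices [[m, v], [0, m]] with v in the bimodule Z[T]. *)
Definition square_zero : Type := (M * bispan T)%type.
HB.instance Definition _ := Choice.on square_zero.
Notation lpush m := (push ((m, 1%g : M) : bimonoid M)).
Notation rpush m := (push ((1%g, m) : bimonoid M)).

Let mul (x y : square_zero) : square_zero :=
  ((x.1 * y.1)%g, rpush y.1 x.2 + lpush x.1 y.2).

Lemma lpushM (m n : M) (v : bispan T) : lpush (m * n)%g v = lpush m (lpush n v).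
Proof. by rewrite -pushM bimulE mulg1. Qed.
Lemma rpushM (m n : M) (v : bispan T) : rpush (m * n)%g v = rpush n (rpush m v).
Proof. by rewrite -pushM bimulE mulg1. Qed.
Lemma lrpush (m n : M) (v : bispan T) : lpush m (rpush n v) = rpush n (lpush m v).
Proof.
by rewrite -!pushM !bimulE !(mul1g, mulg1).
Qed.

Fact square_zeroA : associative mul.
Proof.
move=> x y z; congr pair; rewrite /= ?mulgA // !pushD addrA.
by rewrite rpushM lpushM lrpush.
Qed.
Fact square_zero1l : left_id (1%g, 0) mul.
Proof. by case=> m v; rewrite /mul /= mul1g raddf0 add0r push1. Qed.
Fact square_zero1r : right_id (1%g, 0) mul.
Proof. by case=> m v; rewrite /mul /= mulg1 push0 addr0 push1. Qed.
HB.instance Definition _ :=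
  isMonoid.Build square_zero square_zeroA square_zero1l square_zero1r.

Definition trivial_section (m : M) : square_zero := (m, 0).
Fact trivial_section_morphism : (trivial_section 1%g = 1%g) *
  {morph trivial_section : x y / (x * y)%g}.
Proof.
split=> // m n; rewrite /trivial_section [RHS]/(mul _ _) /mul /=.
rewrite push0 push0 addr0; reflexivity.
Qed.
HB.instance Definition _ :=
  isUMagmaMorphism.Build M square_zero trivial_section trivial_section_morphism.

(** The conjugate of [trivial_section] by the unipotent matrix with entry t, that
is, the section given by the inner derivation m |-> m t - t m. *)
Definition inner_section (t : T) (m : M) : square_zero :=
  (m, lpush m (mrmon t 1) - rpush m (mrmon t 1)).
Fact inner_section_morphism t : (inner_section t 1%g = 1%g) *
  {morph inner_section t : x y / (x * y)%g}.
Proof.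
split=> [|m n]; first by rewrite /inner_section !push1 subrr.
rewrite /inner_section [RHS]/(mul _ _) /mul /=; congr pair.
rewrite lpushM rpushM [X in _ = X + _]pushB [X in _ = _ + X]pushB (lrpush m n).
by rewrite [RHS]addrC addrA subrK.
Qed.
HB.instance Definition _ t := isUMagmaMorphism.Build M square_zero
  (inner_section t) (inner_section_morphism t).
End SquareZero.

Lemma mrmon1_inj (T : choiceType) : injective (fun t : T => mrmon t 1).
Proof.
move=> s t /(congr1 (mrcoef s)); rewrite !mrmonE eqxx.
by case: eqP.
Qed.

(** The inner derivation at the component t of (1, 1) vanishes on A, because
(a, 1) and (1, a) are the ends of an edge. As A dominates, it vanishes on M,
so (m, 1) and (1, m) are in the same component for every m; acting on the right
by b joins (a, b) to (1, a b). *)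
Lemma dominates_pi0_iso (M : monoidType) (A : set M) :
  dominates A -> is_nset_iso (@cayley_pi0_map M A).
Proof.
move=> dA; split; first exact: cayley_pi0_map_equivariant.
pose T : nsetType (bimonoid M) := cayley_pi0 A.
pose cl (v : cayley_vertex M) : T := \pi_(cayley_pi0 A) v.
have clE n v : nact n (cl v) = cl (nact n v).
  by rewrite /cl; exact: (quot_nactE (@cayley_joined_act M A)).
pose t : T := cl (1%g, 1%g).
have comm m : nact ((m, 1%g) : bimonoid M) t = nact ((1%g, m) : bimonoid M) t.
  have fg a : A a -> trivial_section T a = inner_section t a.
    move=> Aa; congr pair; rewrite !push_mon !clE.
    apply/esym/eqP; rewrite subr_eq0; apply/eqP; congr (mrmon _ 1).
    apply/eqmodP/asboolP/rst_sym/rst_step.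
    exists (1%g, 1%g, exist _ a (mem_set Aa)); rewrite /=.
    by rewrite /nact /= /cayley_act /= !mul1g !mulg1.
  have /(congr1 snd)/= /esym/subr0_eq := dA _ (trivial_section T) (inner_section t) fg m.
  by rewrite !push_mon => /mrmon1_inj.
(* the vertex (a, b) is obtained from (1, 1) by acting with (a, 1), then with
   (1, b) *)
have clm v : cl v = cl (1%g, v.1 * v.2)%g.
  have -> : cl v = nact ((1%g, v.2) : bimonoid M) (nact ((v.1, 1%g) : bimonoid M) t).
    rewrite (clE (v.1, 1%g) (1%g, 1%g)) (clE (1%g, v.2)); congr cl.
    by case: v => x y; rewrite /nact /= /cayley_act /= !mul1g !mulg1.
  rewrite comm (clE (1%g, v.1) (1%g, 1%g)) (clE (1%g, v.2)); congr cl.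
  by rewrite /nact /= /cayley_act /= !mul1g.
pose s (m : biset M) : T := cl (1%g, m).
have sK : cancel s (@cayley_pi0_map M A).
  by move=> m; rewrite /s /cl cayley_pi0_mapE mul1g.
have Ks : cancel (@cayley_pi0_map M A) s.
  move=> C; rewrite -[C]reprK cayley_pi0_mapE /s -clm; exact.
exists s; split=> // a m.
by apply: (can_inj Ks); rewrite cayley_pi0_map_equivariant !sK.
Qed.

(** * From the two-sided Cayley digraph to bi-FP_1 *)

Lemma pi0_iso_joined (M : monoidType) (A : set M) (v : cayley_vertex M) :
  is_nset_iso (@cayley_pi0_map M A) ->
  joined (G := two_sided_cayley A) v (1%g, v.1 * v.2)%g.
Proof.
move=> [_ [g [_ Kg _]]].
have /eqmodP : \pi_(cayley_pi0 A) v =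
    \pi_(cayley_pi0 A) ((1%g, v.1 * v.2)%g : cayley_vertex M).
  apply: (can_inj Kg).
  by rewrite !cayley_pi0_mapE /= mul1g.
exact.
Qed.

Section Augmentation.
Context (M : monoidType).
Notation ZM := (monoid_ring M).
Notation ZMM := (free_bimod M unit).

Lemma subrACA (V : zmodType) (a b c d : V) :
  (a - b) - (c - d) = (a - c) - (b - d).
Proof. by rewrite !opprB [d - c]addrC addrACA [- b + d]addrC. Qed.

(** The basis element m (x) m' of ZM (x) ZM, the free bimodule on one generator. *)
Definition bimon (m m' : M) : ZMM := mrmon ((m, m') : bimonoid M, tt) 1.

Lemma bimod_act_bimon (n : bimonoid M) m m' :
  bimod_act n (bimon m m') = bimon (n.1 * m)%g (m' * (n.2 : M))%g.
Proof. exact: bispan_actE. Qed.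

(** Multiplication ZM (x) ZM -> ZM. *)
Definition augmentation : ZMM -> ZM^o :=
  mrlift (fun x : free_nset (bimonoid M) unit =>
    mrmon ((x.1.1 : M) * (x.1.2 : M))%g 1).

Lemma augmentation_hom : bimod_hom augmentation.
Proof.
apply: mrlift_bimod_hom => n [[m m'] []] /=.
rewrite /bimod_act /rscale /GRing.scale /=.
by rewrite [in RHS]mr_mon_mul [in RHS]mr_mon_mul !mulgA.
Qed.

Lemma augmentation_mon m m' : augmentation (bimon m m') = mrmon (m * m')%g 1.
Proof. by rewrite /augmentation mrlift_mon. Qed.

Definition aug_section : ZM -> ZMM := mrlift (bimon 1%g).

Lemma aug_sectionK : cancel aug_section augmentation.
Proof.
move=> x; move: x; apply: mr_additive_ext => //.
  by move=> x y; rewrite /aug_section raddfB (bimod_hom_zmod augmentation_hom).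
by move=> m; rewrite /aug_section mrlift_mon augmentation_mon mul1g.
Qed.

Section Boundary.
Context (A : set M).

(** The cellular boundary of the two-sided Cayley digraph, target minus source. *)
Definition boundary : free_bimod M A -> ZMM :=
  mrlift (fun x : free_nset (bimonoid M) A =>
    bimod_act x.1 (bimon (val x.2) 1%g - bimon 1%g (val x.2))).

Lemma boundary_hom : bimod_hom boundary.
Proof.
exact: (free_bimod_lift_hom (fun a : A => bimon (val a) 1%g - bimon 1%g (val a))).
Qed.

Lemma boundary_mon (m m' : M) a :
  boundary (mrmon ((m, m') : bimonoid M, a) 1) =
  bimon (m * val a)%g m' - bimon m (val a * m')%g.
Proof.
rewrite /boundary mrlift_mon mulr1z bimod_actB !bimod_act_bimon /=.
by rewrite mul1g mulg1.
Qed.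

Lemma augmentation_boundary x : augmentation (boundary x) = 0.
Proof.
move: x; apply: mr_additive_ext => [x y|x y|[[m m'] a]].
- by rewrite (bimod_hom_zmod boundary_hom) (bimod_hom_zmod augmentation_hom).
- by rewrite subrr.
rewrite boundary_mon (bimod_hom_zmod augmentation_hom) !augmentation_mon.
by rewrite mulgA subrr.
Qed.

(** A zigzag of edges telescopes to the difference of its ends. *)
Lemma joined_boundary (v w : cayley_vertex M) :
  joined (G := two_sided_cayley A) v w ->
  exists y, boundary y = bimon v.1 v.2 - bimon w.1 w.2.
Proof.
have BB := bimod_hom_zmod boundary_hom.
have B0 := bimod_hom0 boundary_hom.
move=> /asboolP; elim=> {v w}
  [v w [[[m m'] a] /= [<- <-]]|v|v w _ [y yE]|u v w _ [x xE] _ [y yE]].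
- exists (0 - mrmon ((m, m') : bimonoid M, a) 1).
  by rewrite BB B0 boundary_mon sub0r opprB.
- by exists 0; rewrite B0 subrr.
- by exists (0 - y); rewrite BB B0 yE sub0r opprB.
- exists (x - (0 - y)); rewrite !BB B0 xE yE sub0r opprK.
  by rewrite addrA subrK.
Qed.

Hypothesis pi0A : is_nset_iso (@cayley_pi0_map M A).

(** Modulo boundaries (a, b) equals (1, a b), so every chain x is congruent
to [aug_section (augmentation x)], which is 0 when the augmentation of x is. *)
Lemma boundary_exact x : augmentation x = 0 <-> exists y, boundary y = x.
Proof.
split=> [x0|[y <-]]; last exact: augmentation_boundary.
have BB := bimod_hom_zmod boundary_hom.
suff [y yE] : exists y, boundary y = x - aug_section (augmentation x).
  by exists y; rewrite yE x0 [aug_section 0]raddf0 subr0.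
move: x {x0}; apply: mr_ind => [|x x' [y yE] [y' yE']|[[m m'] []]].
- exists 0; rewrite (bimod_hom0 boundary_hom) (bimod_hom0 augmentation_hom).
  by rewrite [aug_section 0]raddf0 subr0.
- exists (y - y'); rewrite BB yE yE' (bimod_hom_zmod augmentation_hom).
  rewrite [aug_section (_ - _)]raddfB; exact: subrACA.
rewrite -/(bimon m m') augmentation_mon /aug_section mrlift_mon.
apply: (@joined_boundary (m, m') (1%g, m * m')%g).
exact: pi0_iso_joined.
Qed.
End Boundary.
End Augmentation.

Lemma pi0_iso_bi_FP1 (M : monoidType) (A : set M) :
  finite_set A -> is_nset_iso (@cayley_pi0_map M A) -> bi_FP 1 M.
Proof.
move=> fA pi0A; pose ZM := monoid_ring M.
pose C (i : nat) : bimodType ZM ZM :=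
  if i is 0%N then free_bimod M unit else free_bimod M A.
pose d (i : nat) : C i.+1 -> C i :=
  if i is 0%N return C i.+1 -> C i then @boundary M A else id.
exists C, d, (@augmentation M); split.
- move=> [|i] _; split; do ?exact: free_bimod_projective; apply: free_bimod_fg.
    exact: finite_finset.
  by rewrite (eq_finite_set (card_setT A)).
- split; first exact: augmentation_hom.
  by case=> // _; exact: boundary_hom.
- by move=> z; exists (aug_section z); exact: aug_sectionK.
- by move=> _ x; exact: boundary_exact.
- by case.
Qed.

(** * From bi-FP_1 to domination *)

Lemma bimod_act0 (M : monoidType) (V : bimodType (monoid_ring M) (monoid_ring M)) n :
  bimod_act n (0 : V) = 0.
Proof. by have := bimod_actB n (0 : V) 0; rewrite !subrr. Qed.

Section Codomain.
Context (M N : monoidType) (f g : UMagmaMorphism.type M N).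
Notation ZM := (monoid_ring M).
Notation ZMM := (free_bimod M unit).

(** Z[N] -> Z[K], (a, b) |-> f(a) g(b). *)
Definition tensor_map : ZMM -> bispan (twisted f g) :=
  mrlift (fun x : free_nset (bimonoid M) unit =>
    mrmon ((f (x.1.1 : M) * g (x.1.2 : M))%g : twisted f g) 1).

Lemma tensor_map_hom : bimod_hom tensor_map.
Proof.
apply: mrlift_bimod_hom => n [[m m'] []].
rewrite bispan_actE; congr (mrmon _ 1).
by rewrite /nact /= /twisted_act !gmulfM !mulgA.
Qed.

Lemma tensor_map_mon m m' :
  tensor_map (bimon m m') = mrmon ((f m * g m')%g : twisted f g) 1.
Proof. by rewrite /tensor_map mrlift_mon. Qed.

Definition left_support (z : ZMM) : set M :=
  [set x.1.1 | x in [set` mrsupp z]].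

Lemma finite_left_support z : finite_set (left_support z).
Proof. exact/finite_image/finite_fset. Qed.

(** When f and g agree at the left coordinates of z, the map [tensor_map] acts on z
as Z[g] after multiplication, and z multiplies to 0. *)
Lemma tensor_map_eq0 (z : ZMM) :
  (forall a, left_support z a -> f a = g a) -> augmentation z = 0 ->
  tensor_map z = 0.
Proof.
move=> fg z0.
pose G (m : M) : bispan (twisted f g) := mrmon (g m : twisted f g) 1.
have -> : tensor_map z = mrlift (fun x : free_nset (bimonoid M) unit =>
    G ((x.1.1 : M) * (x.1.2 : M))%g) z.
  apply: mrlift_eq => x xz; rewrite /G gmulfM fg //.
  by exists x.
suff GE : forall y, mrlift (fun x : free_nset (bimonoid M) unit =>
    G ((x.1.1 : M) * (x.1.2 : M))%g) y = mrlift G (augmentation y).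
  by rewrite GE z0 [mrlift G 0]raddf0.
apply: mr_additive_ext => [x y|x y|[[m m'] []]].
- by rewrite raddfB.
- by rewrite (bimod_hom_zmod (@augmentation_hom M)) [mrlift G _]raddfB.
by rewrite -/(bimon m m') augmentation_mon !mrlift_mon.
Qed.
End Codomain.

Lemma bimod_hom_span0 (M : monoidType) (U V : bimodType (monoid_ring M) (monoid_ring M))
    (X : set U) (f : U -> V) :
  bimod_hom f -> (forall x, X x -> f x = 0) ->
  forall (v : U) (t : seq (monoid_ring M * U * monoid_ring M)),
    (forall u, u \in t -> X u.1.2) ->
    v = \sum_(u <- t) rscale (u.1.1 *: u.1.2) u.2 -> f v = 0.
Proof.
move=> fh f0 v t tX ->; elim: t tX => [|[[a u] b] t ih] tX.
  by rewrite big_nil (bimod_hom0 fh).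
have f0' w : f w = 0 -> f (- w) = 0.
  by move=> fw; rewrite -[- w]sub0r (bimod_hom_zmod fh) fw (bimod_hom0 fh) subrr.
rewrite big_cons -[X in _ + X]opprK (bimod_hom_zmod fh) /=.
rewrite (proj2 fh) (bimod_homZ fh) f0; last by apply: (tX (a, u, b)); rewrite in_cons eqxx.
rewrite f0' ?ih //; last by move=> w wt; apply: tX; rewrite in_cons wt orbT.
rewrite scaler0 subr0; apply: (addIr (rscale 0 b)).
by rewrite -rscalerDl !add0r.
Qed.

(** A Schanuel argument. Let h : P_0 -> ZM (x) ZM and k : ZM (x) ZM -> P_0 be maps
over ZM. For z in the kernel of multiplication, k z is a boundary d y, so
z = (z - h k z) + h d y. Thus the kernel is generated by u0, the value of
1 - h k at 1 (x) 1, and by the images under h d of generators of P_1. The left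
coordinates of these finitely many elements form a dominating set, since
[tensor_map f g] then kills m (x) 1 - 1 (x) m. *)
Lemma bi_FP1_dominates (M : monoidType) :
  bi_FP 1 M -> exists2 A : set M, finite_set A & dominates A.
Proof.
move=> [P [d [eps [fgP [eps_hom d_hom] eps_surj exact0 _]]]].
have {}d_hom := d_hom 0%N isT; have {}exact0 := exact0 isT.
have [_ P0proj] := fgP 0%N isT; have [[X fX genX] _] := fgP 1%N isT.
have aug_surj (z : (monoid_ring M)^o) : exists x, augmentation x = z.
  by exists (aug_section z); exact: aug_sectionK.
have [h h_hom hE] := P0proj _ _ _ _ (@augmentation_hom M) eps_hom aug_surj.
have {}hE x : augmentation (h x) = eps x := hE x.
have [e eE] := eps_surj 1.
pose k : free_bimod M unit -> P 0%N :=
  mrlift (fun x : free_nset (bimonoid M) unit => bimod_act x.1 e).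
have k_hom : bimod_hom k by exact: (free_bimod_lift_hom (fun=> e)).
have kE x : eps (k x) = augmentation x.
  move: x; apply: mr_additive_ext => [x y|x y|[[m m'] []]].
  - by rewrite (bimod_hom_zmod k_hom) (bimod_hom_zmod eps_hom).
  - exact: (bimod_hom_zmod (@augmentation_hom M)).
  rewrite -/(bimon m m') augmentation_mon /k mrlift_mon mulr1z /=.
  rewrite (bimod_hom_act eps_hom) eE /bimod_act /rscale /GRing.scale /=.
  by rewrite mulr1 mr_mon_mul.
pose u0 := bimon 1%g 1%g - h (k (bimon (1%g : M) 1%g)).
(* 1 - h k takes values in the kernel of multiplication, and as a bimodule map it
   is determined by its value u0 at 1 (x) 1 *)
have aug_hk x : augmentation (x - h (k x)) = 0.
  rewrite (bimod_hom_zmod (@augmentation_hom M)) -kE.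
  by rewrite hE subrr.
exists (left_support u0 `|` \bigcup_(x in X) left_support (h (d 0%N x))).
  rewrite finite_setU; split; first exact: finite_left_support.
  by apply: bigcup_finite => // x _; exact: finite_left_support.
move=> N f g fg m; pose Phi := tensor_map f g.
have Phi_hom : bimod_hom Phi := tensor_map_hom f g.
have Phi_u0 : Phi u0 = 0.
  apply: tensor_map_eq0; last exact: aug_hk.
  by move=> a au; apply: fg; left.
have Phi_hd y : Phi (h (d 0%N y)) = 0.
  have [t tX yE] := genX y.
  apply: (bimod_hom_span0 (X := X) (f := Phi \o (h \o d 0%N)) _ _ tX yE).
    exact: (bimod_hom_comp (bimod_hom_comp d_hom h_hom) Phi_hom).
  move=> x Xx; apply: tensor_map_eq0; first by move=> a ax; apply: fg; right; exists x.
  by rewrite hE; apply/exact0; exists x.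
have Phi_hk z : Phi (z - h (k z)) = 0.
  move: z; apply: mr_additive_ext => [x y|x y|[[m1 m2] []]].
  - rewrite -(bimod_hom_zmod Phi_hom) (bimod_hom_zmod k_hom) (bimod_hom_zmod h_hom).
    by rewrite subrACA.
  - by rewrite subr0.
  have E : bimon m1 m2 = bimod_act ((m1, m2) : bimonoid M) (bimon 1%g 1%g).
    by rewrite bimod_act_bimon /= mulg1 mul1g.
  rewrite -/(bimon m1 m2) E (bimod_hom_act k_hom) (bimod_hom_act h_hom).
  rewrite -bimod_actB (bimod_hom_act Phi_hom) Phi_u0.
  exact: bimod_act0.
have : Phi (bimon m 1%g - bimon 1%g m) = 0.
  set z := (_ - _).
  have [|y yE] := proj1 (exact0 (k z)).
    rewrite kE (bimod_hom_zmod (@augmentation_hom M)) !augmentation_mon.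
    by rewrite mulg1 mul1g subrr.
  have := Phi_hk z; rewrite -yE (bimod_hom_zmod Phi_hom) Phi_hd subr0; exact.
rewrite (bimod_hom_zmod Phi_hom) /Phi !tensor_map_mon => /subr0_eq /mrmon1_inj.
by rewrite !gmulf1 mulg1 mul1g.
Qed.

(** * Continuity *)

Section Pasting.
Context (T U : topologicalType).

(** The three pieces are given by functions that are defined everywhere but need
to be continuous only at the points of the closed set where they are used; this
allows formulas that involve a division. *)
Lemma paste_closed3 (A B C : set T) (f fA fB fC : T -> U) :
  closed A -> closed B -> closed C -> (forall x, [\/ A x, B x | C x]) ->
  (forall x, A x -> f x = fA x /\ {for x, continuous fA}) ->
  (forall x, B x -> f x = fB x /\ {for x, continuous fB}) ->
  (forall x, C x -> f x = fC x /\ {for x, continuous fC}) -> continuous f.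
Proof.
move=> cA cB cC ABC hA hB hC x W Wfx.
have half (D : set T) (g : T -> U) : closed D ->
    (forall x, D x -> f x = g x /\ {for x, continuous g}) ->
    nbhs x [set y | D y -> W (f y)].
  move=> cD fg; have [Dx|nDx] := pselect (D x).
    have [fgx cg] := fg x Dx; have Wg : nbhs (g x) W by rewrite -fgx.
    have : nbhs x (g @^-1` W) := cg W Wg.
    by apply: filterS => y Wy Dy; rewrite /= (proj1 (fg y Dy)).
  have : nbhs x (~` D) by apply: open_nbhs_nbhs; split; [exact: closed_openC|].
  by apply: filterS => y nDy /nDy.
have nA := half A fA cA hA; have nB := half B fB cB hB.
have nC := half C fC cC hC.
suff : nbhs x (f @^-1` W) by [].
by apply: filterS3 nA nB nC => y /= WA WB WC; case: (ABC y).
Qed.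
End Pasting.

Lemma continuous_near_eq (T U : topologicalType) (f g : T -> U) x :
  nbhs x [set y | f y = g y] -> {for x, continuous g} -> {for x, continuous f}.
Proof.
move=> fg cg W; rewrite (nbhs_singleton fg) => /cg.
move=> Wg; suff : nbhs x (f @^-1` W) by [].
by apply: filterS2 fg Wg => y /= ->.
Qed.

Lemma continuous_set_type (T U : topologicalType) (A : set U) (f : T -> A) x :
  {for x, continuous (fun y => set_val (f y))} -> {for x, continuous f}.
Proof.
move=> cf W [_ [[B oB <-] /= Bfx BW]].
have : nbhs x ((fun y => set_val (f y)) @^-1` B).
  by apply: (cf B); apply: open_nbhs_nbhs.
move=> nB; suff : nbhs x (f @^-1` W) by [].
by apply: filterS nB => y By; apply: BW.
Qed.

Lemma set_val_continuous (U : topologicalType) (A : set U) :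
  continuous (set_val : A -> U).
Proof. exact: initial_continuous. Qed.

Lemma continuous_from_discrete (P : choiceType) (U : topologicalType)
    (f : discrete_topology P -> U) : continuous f.
Proof.
move=> x W Wfx; rewrite nbhs_principalE; apply/principal_filterP.
exact: nbhs_singleton Wfx.
Qed.

Lemma continuous_to_discrete (P : choiceType) (T : topologicalType)
    (f : T -> discrete_topology P) :
  (forall x, nbhs x [set y | f y = f x]) -> continuous f.
Proof.
move=> lf x W Wfx; suff : nbhs x (f @^-1` W) by [].
apply: filterS (lf x) => y /= ->.
exact: nbhs_singleton Wfx.
Qed.

Lemma continuous_pair (T U V : topologicalType) (f : T -> U) (g : T -> V) x :
  {for x, continuous f} -> {for x, continuous g} ->
  {for x, continuous (fun y => (f y, g y))}.
Proof. by move=> cf cg; apply: cvg_pair. Qed.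

Lemma continuous_cells (P : choiceType) (B U : topologicalType)
    (f : cells P B -> U) :
  (forall p, continuous (fun b => f (p, b))) -> continuous f.
Proof.
move=> cf [p b] W /(cf p b) Wb.
exists ([set p], [set c | W (f (p, c))]); last first.
  by case=> q c /= [-> ].
by split => //; rewrite nbhs_principalE; apply/principal_filterP.
Qed.

Lemma continuous_cell (P : choiceType) (B U : topologicalType)
    (f : cells P B -> U) p :
  continuous f -> continuous (fun b => f (p, b)).
Proof.
move=> cf b; apply: (@continuous_comp _ _ _ (fun b => (p, b) : cells P B) f).
  apply: (@continuous_pair _ _ _ (fun=> p : discrete_topology P) id).
    exact: cvg_cst.
  exact: cvg_id.
exact: cf.
Qed.

Lemma nact_continuous1 (N : monoidType) (X : nspaceType N) (a : N) :
  continuous (nact a : X -> X).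
Proof.
move=> u W Wu.
have [[U V] /= [Ua Vu] UVW] := @nact_continuous N X (a, u) W Wu.
apply: filterS Vu => v Vv; apply: (UVW (a, v)); split => //=.
by move: Ua; rewrite nbhs_principalE => /principal_filterP.
Qed.

(** * Paths *)

Section Paths.
Context (R : realType).
Notation I := (unit_interval R).

Fact clamp_mem (t : R) : Num.max 0 (Num.min t 1) \in `[0 : R, 1]%classic.
Proof.
by rewrite inE /= in_itv /= le_max lexx /= ge_max ler01 ge_min lexx orbT.
Qed.
Definition clamp (t : R) : I :=
  exist (fun x : R => x \in `[0 : R, 1]%classic) _ (clamp_mem t).

Lemma clamp_continuous : continuous clamp.
Proof.
move=> t; apply: continuous_set_type.
apply: (@continuous_max _ R (cst 0) (fun t => Num.min t 1)); first exact: cvg_cst.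
by apply: (@continuous_min _ R id (cst 1)); [exact: cvg_id|exact: cvg_cst].
Qed.

Lemma clampK (t : I) : clamp (set_val t) = t.
Proof.
apply: val_inj => /=; have := set_valP t; rewrite /= in_itv /= => /andP[t0 t1].
by rewrite min_l // max_r.
Qed.

Lemma val_clamp_id (t : R) : 0 <= t <= 1 -> set_val (clamp t) = t.
Proof. by move=> /andP[t0 t1]; rewrite set_valE /= min_l // max_r. Qed.

Lemma clamp0 : clamp 0 = itv0 R.
Proof. by apply: val_inj => /=; rewrite min_l // max_r. Qed.
Lemma clamp1 : clamp 1 = itv1 R.
Proof. by apply: val_inj => /=; rewrite min_l // max_r. Qed.

Lemma path_relatedP (X : topologicalType) (x y : X) :
  path_related R x y <->
  exists f : R -> X, [/\ continuous f, f 0 = x & f 1 = y].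
Proof.
split=> [/asboolP[p]|[f [cf <- <-]]].
  exists (p \o clamp); split.
  - by move=> t; apply: continuous_comp; [exact: clamp_continuous|exact: cts_fun].
  - by rewrite /= clamp0; exact: path_zero.
  - by rewrite /= clamp1; exact: path_one.
apply/asboolP; constructor.
have cg : continuous (f \o (set_val : I -> R)).
  by move=> t; apply: continuous_comp; [exact: set_val_continuous|exact: cf].
exact: (@mk_path I X (f 0) (f 1) (f \o set_val) cg erefl erefl).
Qed.

Lemma path_related_map (X Y : topologicalType) (u : X -> Y) (x y : X) :
  continuous u -> path_related R x y -> path_related R (u x) (u y).
Proof.
move=> cu /path_relatedP[f [cf <- <-]]; apply/path_relatedP.
exists (u \o f); split=> // t.
by apply: continuous_comp; [exact: cf|exact: cu].
Qed.

(** The line is connected and a fibre of a map to a discrete space is clopen. *)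
Lemma path_related_discrete (P : choiceType) (x y : discrete_topology P) :
  path_related R x y -> x = y.
Proof.
move=> /path_relatedP[f [cf <- <-]].
have oP (B : set (discrete_topology P)) : open B.
  by rewrite openE => z Bz; rewrite /interior nbhs_principalE; apply/principal_filterP.
have cR : connected [set: R] by apply/connected_intervalP.
have E : [set t | f t = f 0] = [set: R].
  apply: cR; first by exists 0.
    exists [set t | f t = f 0]; last by rewrite setTI.
    exact: (open_comp (f := f) _ (oP [set f 0])).
  exists [set t | f t = f 0]; last by rewrite setTI.
  rewrite -[X in closed X]setCK; apply: open_closedC.
  exact: (open_comp (f := f) _ (oP (~` [set f 0]))).
by have : [set t | f t = f 0] 1 by rewrite E.
Qed.

End Paths.

(** * Balls and spheres *)

Section Euclid.
Context (R : realType).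

Lemma continuous_row (T : topologicalType) n (f : T -> 'rV[R]_n) x :
  (forall i, {for x, continuous (fun y => f y 0 i)}) -> {for x, continuous f}.
Proof.
move=> cf W [P fP PW]; suff : nbhs x (f @^-1` W) by [].
have : nbhs x [set y | forall i, P 0 i (f y 0 i)].
  by apply: filter_forall => i; exact: (cf i _ (fP 0 i)).
apply: filterS => y Py; apply: PW => i j.
by rewrite (ord1 i).
Qed.

(** Pointwise forms, for functions of an explicit argument. *)
Section RealAlgebra.
Context (T : topologicalType) (f g : T -> R) (x : T).
Hypothesis cf : {for x, continuous f}.
Lemma continuous_at_inv : f x != 0 -> {for x, continuous (fun y => (f y)^-1)}.
Proof. by move=> fx0; apply: cvgV. Qed.
Lemma continuous_at_opp : {for x, continuous (fun y => - f y)}.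
Proof. exact: cvgN. Qed.
Hypothesis cg : {for x, continuous g}.
Lemma continuous_at_add : {for x, continuous (fun y => f y + g y)}.
Proof. exact: cvgD. Qed.
Lemma continuous_at_sub : {for x, continuous (fun y => f y - g y)}.
Proof. exact: cvgB. Qed.
Lemma continuous_at_mul : {for x, continuous (fun y => f y * g y)}.
Proof. exact: cvgM. Qed.
End RealAlgebra.

Lemma coord_row_continuous n i (x : 'rV[R]_n) :
  {for x, continuous (fun y : 'rV[R]_n => y 0 i)}.
Proof. exact: coord_continuous. Qed.

Section Norm.
Context (n : nat).
Implicit Types x y : 'rV[R]_n.

Definition esq x : R := \sum_i x 0 i ^+ 2.
Definition enorm x : R := Num.sqrt (esq x).

Lemma esq_ge0 x : 0 <= esq x.
Proof. by apply: sumr_ge0 => i _; exact: sqr_ge0. Qed.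

Lemma esqZ c x : esq (c *: x) = c ^+ 2 * esq x.
Proof. by rewrite /esq mulr_sumr; apply: eq_bigr => i _; rewrite mxE exprMn. Qed.

Lemma esq_eq0 x : esq x = 0 -> x = 0.
Proof.
move=> /eqP; rewrite psumr_eq0; last by move=> i _; exact: sqr_ge0.
move=> /allP x0; apply/rowP => i; rewrite mxE.
by have := x0 i (mem_index_enum _); rewrite sqrf_eq0 => /eqP.
Qed.

Lemma enorm_ge0 x : 0 <= enorm x. Proof. exact: sqrtr_ge0. Qed.

Lemma sqr_enorm x : enorm x ^+ 2 = esq x.
Proof. by rewrite sqr_sqrtr // esq_ge0. Qed.

Lemma enormZ c x : enorm (c *: x) = `|c| * enorm x.
Proof. by rewrite /enorm esqZ sqrtrM ?sqr_ge0 // sqrtr_sqr. Qed.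

Lemma enorm_eq0 x : enorm x = 0 -> x = 0.
Proof. by move=> x0; apply: esq_eq0; rewrite -sqr_enorm x0 expr0n. Qed.

Lemma enorm_gt0 x : x != 0 -> 0 < enorm x.
Proof.
by move=> x0; rewrite lt_neqAle enorm_ge0 andbT eq_sym;
  apply: contra x0 => /eqP/enorm_eq0 ->.
Qed.

Lemma esq_continuous : continuous esq.
Proof.
rewrite /esq; elim: (index_enum _) => [|i r ih] x.
  have -> : (fun y : 'rV[R]_n => \sum_(j <- [::]) y 0 j ^+ 2) = cst 0.
    by apply/funext => y; rewrite big_nil.
  exact: cst_continuous.
have -> : (fun y : 'rV[R]_n => \sum_(j <- i :: r) y 0 j ^+ 2) =
    (fun y => y 0 i * y 0 i + \sum_(j <- r) y 0 j ^+ 2).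
  by apply/funext => y; rewrite big_cons expr2.
apply: (@continuous_at_add 'rV[R]_n); last exact: ih.
by apply: (@continuous_at_mul 'rV[R]_n); exact: coord_row_continuous.
Qed.

Lemma enorm_continuous : continuous enorm.
Proof.
move=> x; apply: (@continuous_comp _ _ _ esq); first exact: esq_continuous.
exact: sqrt_continuous.
Qed.

Lemma enorm_ball (b : eball R n) : enorm (set_val b) <= 1.
Proof.
have := set_valP b; rewrite /eball /= -/(esq _) => b1.
by rewrite -[leRHS]sqrtr1 ler_wsqrtr.
Qed.

Lemma enorm_sphere (s : esphere R n) : enorm (set_val s) = 1.
Proof.
by have := set_valP s; rewrite /esphere /= -/(esq _) /enorm => ->; rewrite sqrtr1.
Qed.

Fact retract_mem x : (Num.max 1 (enorm x))^-1 *: x \in eball R n.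
Proof.
set m := Num.max _ _; have m1 : 1 <= m by rewrite le_max lexx.
have m0 : 0 < m by exact: lt_le_trans m1.
rewrite inE /eball /= -/(esq _) esqZ exprVn mulrC ler_pdivrMr ?exprn_gt0 //.
rewrite mul1r -sqr_enorm ler_pXn2r ?nnegrE ?enorm_ge0 ?(ltW m0) //.
by rewrite le_max lexx orbT.
Qed.
(** The ball is a retract of the whole space; the retraction is radial. *)
Definition retract x : eball R n :=
  exist (fun x => x \in eball R n) _ (retract_mem x).

Lemma retract_continuous : continuous retract.
Proof.
move=> x; apply: continuous_set_type.
apply: continuous_row => i.
have -> : (fun y => set_val (retract y) 0 i) =
    (fun y => (Num.max 1 (enorm y))^-1 * y 0 i).
  by apply/funext => y; rewrite set_valE /= mxE.
apply: (@continuous_at_mul 'rV[R]_n); last exact: coord_row_continuous.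
apply: (@continuous_at_inv 'rV[R]_n); last by rewrite gt_eqF // lt_max ltr01.
apply: (@continuous_max _ _ (cst 1) enorm); first exact: cst_continuous.
exact: enorm_continuous.
Qed.

Lemma retractK (b : eball R n) : retract (set_val b) = b.
Proof.
apply: val_inj; rewrite /= max_l ?invr1 ?scale1r //.
exact: enorm_ball.
Qed.

(** The segment from b to c stays in the ball by convexity; composing it with the
retraction makes this membership automatic. *)
Lemma ball_path_connected (b c : eball R n) : path_related R b c.
Proof.
apply/path_relatedP.
pose q (t : R) : 'rV[R]_n := (1 - t) *: set_val b + t *: set_val c.
have cq : continuous q.
  move=> t; apply: continuous_row => i.
  have -> : (fun u => q u 0 i) =
      (fun u => (1 - u) * set_val b 0 i + u * set_val c 0 i).
    by apply/funext => u; rewrite !mxE.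
  apply: (@continuous_at_add R); apply: (@continuous_at_mul R); try exact: cst_continuous.
    by apply: (@continuous_at_sub R); [exact: cst_continuous|exact: cvg_id].
  exact: cvg_id.
exists (fun t => retract (q t)); split.
- by move=> t; apply: (@continuous_comp R 'rV[R]_n _ q); [exact: cq|exact: retract_continuous].
- by rewrite /q subr0 scale1r scale0r addr0 retractK.
- by rewrite /q subrr scale1r scale0r add0r retractK.
Qed.
End Norm.

Section Sphere.
Context (n : nat).
Implicit Types x : 'rV[R]_n.+1.

Fact pole_mem : delta_mx 0 0 \in esphere R n.+1.
Proof.
rewrite inE /esphere /= (bigD1 ord0) //= big1 => [|i i0].
  by rewrite mxE !eqxx expr1n addr0.
by rewrite mxE (negbTE i0) andbF expr0n.
Qed.
Definition pole : esphere R n.+1 :=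
  exist (fun x => x \in esphere R n.+1) _ pole_mem.

(** Radial projection to the sphere. It is continuous away from 0, where it takes
the default value [pole]. *)
Definition direction x : esphere R n.+1 := insubd pole ((enorm x)^-1 *: x).

Lemma val_direction x : x != 0 -> set_val (direction x) = (enorm x)^-1 *: x.
Proof.
move=> x0; rewrite set_valE val_insubd ifT //.
rewrite inE /esphere /= -/(esq _) esqZ exprVn sqr_enorm mulVf //.
by apply: contra x0 => /eqP/esq_eq0 ->.
Qed.

Lemma directionZ c x : 0 < c -> x != 0 -> direction (c *: x) = direction x.
Proof.
move=> c0 x0; apply: val_inj; rewrite -!set_valE !val_direction //; last first.
  by rewrite scaler_eq0 negb_or gt_eqF.
rewrite enormZ gtr0_norm // invfM scalerA mulrAC.
by rewrite mulVf ?gt_eqF // mul1r.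
Qed.

Lemma sphere_neq0 (s : esphere R n.+1) : set_val s != 0.
Proof.
apply/eqP => s0; have := enorm_sphere s.
rewrite s0 -(scale0r (0 : 'rV[R]_n.+1)) enormZ normr0 mul0r => /eqP.
by rewrite eq_sym oner_eq0.
Qed.

Lemma directionK (s : esphere R n.+1) : direction (set_val s) = s.
Proof.
apply: val_inj; rewrite -set_valE val_direction ?sphere_neq0 //.
by rewrite enorm_sphere invr1 scale1r.
Qed.

Lemma direction_continuous x : x != 0 -> {for x, continuous direction}.
Proof.
move=> x0; apply: continuous_set_type.
have nx0 : enorm x != 0 by rewrite gt_eqF // enorm_gt0.
have nz : nbhs x [set y : 'rV[R]_n.+1 | enorm y != 0].
  have : open [set r : R | r != 0] by apply: open_neq.
  by move=> /(open_comp (f := enorm (n := n.+1)) (fun y _ => @enorm_continuous n.+1 y)) oU;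
    apply: open_nbhs_nbhs.
apply: (@continuous_near_eq _ _ _ (fun y => (enorm y)^-1 *: y)).
  apply: filterS nz => y /= ny0; apply: val_direction.
  by apply: contra ny0 => /eqP ->; rewrite -(scale0r 0) enormZ normr0 mul0r.
apply: continuous_row => i.
have -> : (fun y : 'rV[R]_n.+1 => ((enorm y)^-1 *: y) 0 i) =
    (fun y => (enorm y)^-1 * y 0 i).
  by apply/funext => y; rewrite mxE.
apply: (@continuous_at_mul 'rV[R]_n.+1); last exact: coord_row_continuous.
by apply: (@continuous_at_inv 'rV[R]_n.+1); first exact: enorm_continuous.
Qed.

(** Outside the open ball the two radial projections agree. *)
Lemma retract_direction x : 1 <= enorm x ->
  retract x = esphere_incl (direction x).
Proof.
move=> x1; apply: val_inj; rewrite /= max_r // -val_direction //.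
apply: contraTneq x1 => ->; rewrite -(scale0r 0) enormZ normr0 mul0r.
by rewrite -ltNge ltr01.
Qed.

Lemma esphere_incl_continuous : continuous (@esphere_incl R n).
Proof. by move=> s; apply: continuous_set_type; exact: set_val_continuous. Qed.

End Sphere.
End Euclid.

Section Cylinder.
Context (R : realType).

Lemma enorm0 n : enorm (0 : 'rV[R]_n) = 0.
Proof. by rewrite -(scale0r 0) enormZ normr0 mul0r. Qed.

(** When s and t are not antipodal, the segment between them avoids 0 and can be
projected to the sphere: if (1 - u) s = - u t, comparing norms gives u = 1/2
and t = - s. *)
Lemma sphere_path_segment n (s t : esphere R n.+1) :
  set_val s + set_val t != 0 -> path_related R s t.
Proof.
move=> st; apply/path_relatedP.
pose q (u : R) : 'rV[R]_n.+1 := (1 - u) *: set_val s + u *: set_val t.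
have q0 u : q u != 0.
  apply: contra st => /eqP; rewrite /q => /eqP; rewrite addr_eq0 => /eqP E.
  have Eu : (1 - u) ^+ 2 = u ^+ 2.
    have := congr1 (@esq R n.+1) E; rewrite -scaleNr !esqZ sqrrN.
    by rewrite -!sqr_enorm !enorm_sphere !expr1n !mulr1.
  have u2 : u = 2^-1 by move: Eu; rewrite !expr2; lra.
  move: E; rewrite u2 (_ : 1 - 2^-1 = 2^-1); last by lra.
  rewrite -scalerN => /scalerI -> //; first by rewrite addNr.
  by rewrite invr_eq0 pnatr_eq0.
have cq : continuous q.
  move=> u; apply: continuous_row => i.
  have -> : (fun u => q u 0 i) =
      (fun u => (1 - u) * set_val s 0 i + u * set_val t 0 i).
    by apply/funext => v; rewrite !mxE.
  apply: (@continuous_at_add R R); apply: (@continuous_at_mul R R); try exact: cst_continuous.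
    by apply: (@continuous_at_sub R R); [exact: cst_continuous|exact: cvg_id].
  exact: cvg_id.
exists (fun u => direction (q u)); split.
- move=> u; apply: (@continuous_comp R 'rV[R]_n.+1 _ q); first exact: cq.
  exact: direction_continuous.
- by rewrite /q subr0 scale1r scale0r addr0 directionK.
- by rewrite /q subrr scale1r scale0r add0r directionK.
Qed.

(** Every point is joined to [pole] by a segment, except its antipode, which reaches
it through a point w off the axis of [pole]; such a w exists because the sphere
has positive dimension. *)
Lemma sphere_path_connected n (s t : esphere R n.+2) : path_related R s t.
Proof.
suff H (u : esphere R n.+2) : path_related R u (pole R n.+1).
  by apply: path_related_trans (H s) _; rewrite path_related_sym.
have [E|] := eqVneq (set_val u + set_val (pole R n.+1)) 0; last first.
  exact: sphere_path_segment.
pose w : 'rV[R]_n.+2 := delta_mx 0 (lift ord0 ord0).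
have w0 : w != 0.
  apply/eqP => /rowP/(_ (lift ord0 ord0)); rewrite !mxE !eqxx => /eqP.
  by rewrite oner_eq0.
have cw c : set_val (direction w) + c *: delta_mx 0 ord0 != 0 :> 'rV[R]_n.+2.
  apply/eqP => /rowP/(_ (lift ord0 ord0)).
  rewrite val_direction // !mxE !eqxx /= mulr0 addr0 mulr1 => /eqP.
  by rewrite invr_eq0 gt_eqF // enorm_gt0.
have uE : set_val u = (-1) *: delta_mx 0 ord0.
  by apply/eqP; rewrite scaleN1r -addr_eq0; apply/eqP.
apply: (@path_related_trans R _ (direction w)).
  by apply: sphere_path_segment; rewrite addrC uE; exact: cw.
apply: sphere_path_segment; have := cw 1; rewrite scale1r; exact.
Qed.

Section Coordinates.
Context (n : nat).

(** The point of R^(n+1) with first coordinate t and remaining coordinates x. *)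
Definition cyl (x : 'rV[R]_n) (t : R) : 'rV[R]_n.+1 :=
  \row_j oapp (fun i => x 0 i) t (unlift ord0 j).
Definition tail (z : 'rV[R]_n.+1) : 'rV[R]_n := \row_i z 0 (lift ord0 i).

Lemma cyl0 x t : cyl x t 0 ord0 = t.
Proof. by rewrite mxE unlift_none. Qed.
Lemma tail_cyl x t : tail (cyl x t) = x.
Proof. by apply/rowP => i; rewrite !mxE liftK. Qed.
Lemma tailZ c z : tail (c *: z) = c *: tail z.
Proof. by apply/rowP => i; rewrite !mxE. Qed.
Lemma esq_tail z : esq z = z 0 ord0 ^+ 2 + esq (tail z).
Proof.
rewrite /esq big_ord_recl; congr (_ + _).
by apply: eq_bigr => i _; rewrite mxE.
Qed.

Lemma tail_continuous : continuous tail.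
Proof.
move=> z; apply: continuous_row => i.
have -> : (fun y => tail y 0 i) = (fun y => y 0 (lift ord0 i)).
  by apply/funext => y; rewrite mxE.
exact: coord_row_continuous.
Qed.

Lemma cyl_continuous (T : topologicalType) (f : T -> 'rV[R]_n) (g : T -> R) x :
  {for x, continuous f} -> {for x, continuous g} ->
  {for x, continuous (fun y => cyl (f y) (g y))}.
Proof.
move=> cf cg; apply: continuous_row => j.
case: (unliftP ord0 j) => [i ->|->].
  have -> : (fun y => cyl (f y) (g y) 0 (lift ord0 i)) = (fun y => f y 0 i).
    by apply/funext => y; rewrite mxE liftK.
  apply: (@continuous_comp _ _ _ f (fun z : 'rV[R]_n => z 0 i)) => //.
  exact: coord_row_continuous.
have -> // : (fun y => cyl (f y) (g y) 0 ord0) = g.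
by apply/funext => y; rewrite cyl0.
Qed.
End Coordinates.
End Cylinder.

(** * Extension over a cylinder *)

Section ExtendCylinder.
Context (R : realType) (n : nat) (Y Y' : topologicalType) (j : Y -> Y').

(** Every map of a sphere to Y becomes null-homotopic in Y'. *)
Definition extends_spheres (m : nat) : Prop :=
  forall phi : esphere R m -> Y, continuous phi ->
  exists2 Phi : eball R m -> Y', continuous Phi &
    forall s, Phi (esphere_incl s) = j (phi s).

(** The boundary of B x [-1, 1] is a sphere: in coordinates y in R^(n+1) and z0 in R,
the radial projection takes it to the unit sphere, whose points with
z0 <= -|y|, z0 >= |y| and |z0| <= |y| come from the bottom, the top and the side
of the cylinder. The data g, c and h on these parts define a map f on the sphere;
its extension over the ball, composed with the radial map of the cylinder to the
ball, is G. The parameter t of the cylinder corresponds to z0 = 2 t - 1. *)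
Lemma extend_cylinder (g : eball R n.+1 -> Y) (h : esphere R n.+1 * R -> Y)
    (c : Y) :
  extends_spheres n.+2 -> continuous g -> continuous h ->
  (forall s, h (s, 0) = g (esphere_incl s)) -> (forall s, h (s, 1) = c) ->
  exists G : eball R n.+1 * R -> Y',
    [/\ continuous G, forall b, G (b, 0) = j (g b), forall b, G (b, 1) = j c &
      forall s t, 0 <= t <= 1 -> G (esphere_incl s, t) = j (h (s, t))].
Proof.
move=> ext cg ch h0 h1.
pose z0 (z : esphere R n.+2) : R := set_val z 0 ord0.
pose y (z : esphere R n.+2) := tail (set_val z).
pose m (z : esphere R n.+2) := enorm (y z).
have m_ge0 z : 0 <= m z by exact: enorm_ge0.
have z0m z : z0 z ^+ 2 + m z ^+ 2 = 1.
  rewrite sqr_enorm -[LHS]esq_tail -sqr_enorm enorm_sphere expr1n; exact.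
have cz0 : continuous z0.
  move=> z; apply: (@continuous_comp _ 'rV[R]_n.+2 _ set_val (fun x => x 0 ord0)).
    exact: set_val_continuous.
  exact: coord_row_continuous.
have cy : continuous y.
  move=> z; apply: (@continuous_comp _ 'rV[R]_n.+2 'rV[R]_n.+1 set_val (@tail R n.+1)).
    exact: set_val_continuous.
  exact: tail_continuous.
have cm : continuous m.
  move=> z; apply: (@continuous_comp _ 'rV[R]_n.+1 _ y); first exact: cy.
  exact: enorm_continuous.
pose A := [set z | z0 z <= - m z]; pose B := [set z | m z <= z0 z].
pose C := [set z | - m z <= z0 z /\ z0 z <= m z].
(* bottom and side of the cylinder, read off after radial projection *)
pose fA z := g (retract ((- z0 z)^-1 *: y z)).
pose fC z := h (direction (y z), (z0 z / m z + 1) / 2).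
pose f z := if z0 z <= - m z then fA z else if m z <= z0 z then c else fC z.
(* z0 vanishes nowhere on A or B, and |y| vanishes nowhere on C, because
   z0^2 + |y|^2 = 1 *)
have Alt z : A z -> z0 z < 0.
  by move=> Az; move: (z0m z) (m_ge0 z) Az; rewrite /A /= !expr2; nra.
have Bgt z : B z -> 0 < z0 z.
  by move=> Bz; move: (z0m z) (m_ge0 z) Bz; rewrite /B /= !expr2; nra.
have Cgt z : C z -> 0 < m z.
  by move=> [C1 C2]; move: (z0m z) (m_ge0 z) C1 C2; rewrite !expr2; nra.
have y_neq0 z : C z -> y z != 0.
  by move=> /Cgt; apply: contraTneq; rewrite /m => ->; rewrite enorm0 ltxx.
have leF (F G : esphere R n.+2 -> R) : continuous F -> continuous G ->
    closed [set z | F z <= G z].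
  move=> cF cG.
  have -> : [set z | F z <= G z] = (fun z => F z - G z) @^-1` [set r : R | r <= 0].
    by apply/seteqP; split=> z /=; rewrite subr_le0.
  apply: preimage_closed; last exact: closed_le.
  by move=> z _; apply: (@continuous_at_sub R (esphere R n.+2)); [exact: cF|exact: cG].
have cmN : continuous (fun z => - m z).
  by move=> z; apply: (@continuous_at_opp R (esphere R n.+2)); exact: cm.
(* the pieces match: at z0 = -|y| by the hypothesis on h at 0, at z0 = |y| by
   the one at 1 *)
have fCE z : C z -> f z = fC z.
  move=> Cz; have m0 := Cgt z Cz; have mN0 : m z != 0 by rewrite gt_eqF.
  rewrite /f; case: ifPn => [zA|_]; last case: ifPn => [zB|//].
    have E : z0 z = - m z by apply/eqP; rewrite eq_le zA (proj1 Cz).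
    rewrite /fA /fC E opprK mulNr divff // addNr mul0r h0.
    rewrite retract_direction ?directionZ ?invr_gt0 ?y_neq0 //.
    by rewrite enormZ ger0_norm ?invr_ge0 ?m_ge0 // -/(m z) mulVf.
  have E : z0 z = m z by apply/eqP; rewrite eq_le zB (proj2 Cz).
  by rewrite /fC E divff // -[1 + 1]/(2%:R) divff ?h1 // pnatr_eq0.
have cf : continuous f.
  apply: (@paste_closed3 _ _ A B C f fA (fun=> c) fC).
  - exact: leF.
  - exact: leF.
  - by apply: closedI; exact: leF.
  - move=> z; rewrite /A /B /C /=.
    have [?|zA] := lerP (z0 z) (- m z); first by constructor 1.
    have [?|zB] := lerP (m z) (z0 z); first by constructor 2.
    by constructor 3; rewrite !ltW.
  - move=> z Az; split; first by rewrite /f ifT.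
    apply: (@continuous_comp _ 'rV[R]_n.+1 _ (fun z => (- z0 z)^-1 *: y z)
      (g \o @retract R n.+1)); last first.
      by apply: continuous_comp; [exact: retract_continuous|exact: cg].
    apply: continuous_row => i.
    have -> : (fun z => ((- z0 z)^-1 *: y z) 0 i) = (fun z => (- z0 z)^-1 * y z 0 i).
      by apply/funext => v; rewrite mxE.
    apply: (@continuous_at_mul R (esphere R n.+2)).
      apply: (@continuous_at_inv R (esphere R n.+2)).
        by apply: (@continuous_at_opp R (esphere R n.+2)); exact: cz0.
      by rewrite oppr_eq0 lt_eqF // Alt.
    apply: (@continuous_comp _ 'rV[R]_n.+1 _ y (fun x => x 0 i)); first exact: cy.
    exact: coord_row_continuous.
  - move=> z Bz; split; last exact: cst_continuous.
    rewrite /f ifF; first by rewrite ifT.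
    by apply/negP => /Alt; rewrite ltNge ltW // Bgt.
  - move=> z Cz; have m0 := Cgt z Cz; have mN0 : m z != 0 by rewrite gt_eqF.
    split; first exact: fCE.
    apply: (@continuous_comp _ (esphere R n.+1 * R)%type _
      (fun z => (direction (y z), (z0 z / m z + 1) / 2)) h); last exact: ch.
    apply: (@continuous_pair (esphere R n.+2)).
      apply: (@continuous_comp _ 'rV[R]_n.+1 _ y); first exact: cy.
      by apply: direction_continuous; exact: y_neq0.
    apply: (@continuous_at_mul R (esphere R n.+2)); last exact: cst_continuous.
    apply: (@continuous_at_add R (esphere R n.+2)); last exact: cst_continuous.
    apply: (@continuous_at_mul R (esphere R n.+2)); first exact: cz0.
    by apply: (@continuous_at_inv R (esphere R n.+2)); first exact: cm.
have [Phi cPhi PhiE] := ext f cf.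
(* only points of norm at least 1 are radially projected; the others stay where
   they are, inside the ball *)
pose w (p : eball R n.+1 * R) := cyl (set_val p.1) (2 * p.2 - 1).
have wE (p : eball R n.+1 * R) : 1 <= esq (w p) -> let e := enorm (w p) in
    [/\ 0 < e, Phi (retract (w p)) = j (f (direction (w p))),
      z0 (direction (w p)) = e^-1 * (2 * p.2 - 1),
      y (direction (w p)) = e^-1 *: set_val p.1 &
      m (direction (w p)) = e^-1 * enorm (set_val p.1)].
  move=> w1 e; have e1 : 1 <= e by rewrite -[leLHS]sqrtr1 ler_wsqrtr.
  have e0 : 0 < e by exact: lt_le_trans e1.
  have wn0 : w p != 0 by apply: contraTneq e0; rewrite /e => ->; rewrite enorm0 ltxx.
  have yE : y (direction (w p)) = e^-1 *: set_val p.1.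
    by rewrite /y val_direction // tailZ tail_cyl.
  split=> //.
  - by rewrite (retract_direction e1) PhiE.
  - by rewrite /z0 val_direction // mxE cyl0.
  - by rewrite /m yE enormZ gtr0_norm // invr_gt0.
have esq_w p : esq (w p) = (2 * p.2 - 1) ^+ 2 + esq (set_val p.1).
  by rewrite esq_tail cyl0 tail_cyl.
exists (fun p => Phi (retract (w p))); split.
- move=> p; apply: (@continuous_comp _ 'rV[R]_n.+2 _ w (Phi \o @retract R n.+2)).
    apply: cyl_continuous.
      apply: (@continuous_comp _ _ 'rV[R]_n.+1 fst); first exact: cvg_fst.
      exact: set_val_continuous.
    apply: (@continuous_at_sub R (eball R n.+1 * R)%type); last exact: cst_continuous.
    apply: (@continuous_at_mul R (eball R n.+1 * R)%type); last exact: cvg_snd.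
    exact: cst_continuous.
  by apply: continuous_comp; [exact: retract_continuous|exact: cPhi].
- move=> b; have [] := wE (b, 0).
    by rewrite esq_w /= mulr0 sub0r sqrrN expr1n lerDl esq_ge0.
  set d := direction _ => e0 -> zE yE mE; congr j.
  rewrite /= mulr0 sub0r mulrN1 in zE; rewrite /= in yE mE.
  rewrite /f ifT; last first.
    by rewrite zE mE lerN2 ler_piMr ?invr_ge0 ?enorm_ball // ltW.
  rewrite /fA zE yE opprK invrK scalerA mulfV ?gt_eqF // scale1r.
  by rewrite retractK.
- move=> b; have [] := wE (b, 1).
    by rewrite esq_w /= mulr1 (_ : 2 - 1 = 1) ?expr1n ?lerDl ?esq_ge0 //; lra.
  set d := direction _ => e0 -> zE yE mE; congr j.
  rewrite /= mulr1 (_ : 2 - 1 = 1) ?mulr1 in zE; last by lra.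
  rewrite /= in yE mE.
  have Bd : B d by rewrite /B /= zE mE ler_piMr ?invr_ge0 ?enorm_ball // ltW.
  rewrite /f ifF; first by rewrite ifT.
  by apply/negP => /Alt; rewrite ltNge ltW // Bgt.
- move=> s t /andP[t0 t1]; have [] := wE (esphere_incl s, t).
    rewrite esq_w /= -sqr_enorm -/(set_val s).
    by rewrite enorm_sphere expr1n lerDr sqr_ge0.
  set d := direction _ => e0 -> zE yE mE; congr j.
  have vs : set_val (esphere_incl s) = set_val s by [].
  rewrite /= vs in yE mE; rewrite /= in zE.
  rewrite enorm_sphere mulr1 in mE; set e := enorm _ in e0 zE yE mE.
  have ei0 : 0 < e^-1 by rewrite invr_gt0.
  have Cd : C d by rewrite /C /= zE mE; split; nra.
  rewrite fCE // /fC yE directionZ ?sphere_neq0 // directionK zE mE; congr (h (_, _)).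
  by field; rewrite gt_eqF.
Qed.
End ExtendCylinder.

(** * From bi-F_1 to domination *)

(** The coinduced N-set of predicates on N, with the indiscrete topology, detects
equality of subsets: any predicate P on an N-space X gives an N-map
x |-> (b |-> P (b x)), without continuity or invariance assumptions on P. The
uniqueness part of a universal property, applied to these maps, becomes an
induction principle. *)
Definition coinduced (N : Type) : Type := N -> Prop.

Section Coinduced.
Context (N : monoidType).
Let T := coinduced N.
HB.instance Definition _ := gen_eqMixin T.
HB.instance Definition _ := gen_choiceMixin T.

Let op : set_system T := [set set0; setT].
Let opT : op setT. Proof. by right. Qed.
Let opI : setI_closed op.
Proof.
move=> A B [] -> [] ->; rewrite ?set0I ?setI0 ?setTI; by [left|right].
Qed.
Let op_bigU (I : Type) (f : I -> set T) :
  (forall i, op (f i)) -> op (\bigcup_i f i).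
Proof.
move=> fop; have [[i fi]|nf] := pselect (exists i, f i = setT).
  by right; apply/seteqP; split=> // x _; exists i => //; rewrite fi.
left; apply/seteqP; split=> // x [i _ fix_].
by case: (fop i) => E; [rewrite E in fix_|case: nf; exists i].
Qed.
HB.instance Definition _ := isOpenTopological.Build T opT opI op_bigU.

Lemma coinduced_continuous (X : topologicalType) (f : X -> T) : continuous f.
Proof.
move=> x W [B [/= [->|->] Bx BW]] //.
suff -> : W = setT by exact: filterT.
by apply/seteqP; split.
Qed.

Definition coinduced_act (a : N) (phi : T) : T := fun b => phi (b * a)%g.
Fact coinduced_act1 phi : coinduced_act 1%g phi = phi.
Proof. by apply/funext => b; rewrite /coinduced_act mulg1. Qed.
Fact coinduced_actM a b phi :
  coinduced_act (a * b)%g phi = coinduced_act a (coinduced_act b phi).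
Proof. by apply/funext => c; rewrite /coinduced_act mulgA. Qed.
HB.instance Definition _ := isNSet.Build N T coinduced_act1 coinduced_actM.
Fact coinduced_act_continuous :
  continuous (fun p : discrete_topology N * T => nact p.1 p.2).
Proof. exact: coinduced_continuous. Qed.
HB.instance Definition _ := NSet_isNSpace.Build N T coinduced_act_continuous.

Definition test_map (X : nspaceType N) (P : X -> Prop) (x : X) : T :=
  fun b => P (nact b x).

Lemma test_map_nmap (X : nspaceType N) (P : X -> Prop) : nmap (test_map P).
Proof.
split; first exact: coinduced_continuous.
by move=> a x; apply/funext => b; rewrite /test_map -nactM.
Qed.

Lemma test_mapP (X : nspaceType N) (P : X -> Prop) x : test_map P x 1%g = P x.
Proof. by rewrite /test_map nact1. Qed.

Lemma test_map_comp (X Y : nspaceType N) (f : X -> Y) (P : Y -> Prop) x :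
  equivariant f -> (forall x, P (f x)) ->
  test_map P (f x) = test_map (fun _ : X => True) x.
Proof.
move=> fe fP; apply/funext => b; rewrite /test_map -fe; apply/propext.
by split.
Qed.

(** The N-maps defined by P and by the constant predicate True agree on X and on B,
hence on Y. *)
Lemma pushout_ind (S B X Y : nspaceType N) (i : S -> B) (f : S -> X)
    (j : X -> Y) (g : B -> Y) (P : Y -> Prop) :
  is_nspace_pushout i f j g ->
  (forall x, P (j x)) -> (forall b, P (g b)) -> forall y, P y.
Proof.
move=> [[_ je] [_ ge] jg univ] Pj Pg y.
have tX := test_map_nmap (fun _ : X => True).
have tB := test_map_nmap (fun _ : B => True).
have E : test_map (fun _ : X => True) \o f =1 test_map (fun _ : B => True) \o i by [].
have [h [_ hU]] := univ _ _ _ tX tB E.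
have h1 : h = test_map P.
  by apply: hU; split=> [|x|b]; [exact: test_map_nmap|exact: test_map_comp..].
have h2 : h = test_map (fun _ : Y => True).
  by apply: hU; split=> [|x|b]; [exact: test_map_nmap|exact: test_map_comp..].
have := test_mapP P y; rewrite -h1 h2 /test_map => <-; exact.
Qed.

Lemma colim_ind (X : nat -> nspaceType N) (i : forall n, X n -> X n.+1)
    (Y : nspaceType N) (j : forall n, X n -> Y) (P : Y -> Prop) :
  is_nspace_colim i j -> (forall n x, P (j n x)) -> forall y, P y.
Proof.
move=> [jm ji univ] Pj y.
have tX n := test_map_nmap (fun _ : X n => True).
have E n : test_map (fun _ : X n.+1 => True) \o i n =1 test_map (fun _ : X n => True) by [].
have [h [_ hU]] := univ _ _ tX E.
have h1 : h = test_map P.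
  apply: hU; split=> [|n x]; first exact: test_map_nmap.
  by apply: test_map_comp; [exact: (proj2 (jm n))|exact: Pj].
have h2 : h = test_map (fun _ : Y => True).
  apply: hU; split=> [|n x]; first exact: test_map_nmap.
  by apply: test_map_comp => //; exact: (proj2 (jm n)).
have := test_mapP P y; rewrite -h1 h2 /test_map => <-; exact.
Qed.
End Coinduced.

Section CW.
Context (R : realType) (N : monoidType) (X : nspaceType N).
Context (C : projective_cw R X).

Notation skincl := (@cw_skel_incl _ _ _ C _).

Definition cw_vertex (p : cw_cell C 0) : X :=
  skincl (@cw_skel0 _ _ _ C p).

Lemma cw_skel_incl_nmap n : nmap (@cw_skel_incl _ _ _ C n).
Proof. by have [H _ _] := cw_colim C; exact: H. Qed.

Lemma cw_skel_incl_incl n x :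
  skincl (@cw_incl _ _ _ C n x) = skincl x.
Proof. by have [_ H _] := cw_colim C; exact: H. Qed.

Lemma cw_char_path n q (b b' : eball R n.+1) :
  path_related R (skincl (@cw_char _ _ _ C n (q, b)))
    (skincl (@cw_char _ _ _ C n (q, b'))).
Proof.
have [_ [cc _] _ _] := cw_pushout C n.
apply: (path_related_map (u := fun b => skincl (@cw_char _ _ _ C n (q, b)))).
  move=> c; apply: (@continuous_comp _ _ _ (fun b => @cw_char _ _ _ C n (q, b))).
    exact: (continuous_cell cc).
  exact: (proj1 (cw_skel_incl_nmap _)).
exact: ball_path_connected.
Qed.

Lemma cw_char_incl n q (s : esphere R n.+1) :
  skincl (@cw_char _ _ _ C n (q, esphere_incl s)) =
  skincl (@cw_attach _ _ _ C n (q, s)).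
Proof.
have [_ _ E _] := cw_pushout C n.
rewrite -(cw_skel_incl_incl (@cw_attach _ _ _ C n (q, s))).
by congr (skincl _); exact: esym (E (q, s)).
Qed.

(** Each cell is path connected and meets the previous skeleton. *)
Lemma cw_path_to_vertex (x : X) : exists p, path_related R x (cw_vertex p).
Proof.
apply: (colim_ind (P := fun x => exists p, path_related R x (cw_vertex p)) (cw_colim C)).
elim=> [|n ih] {}x.
  have [_ [k [_ _ kK]]] := cw_skel0_iso C.
  by exists (k x); rewrite /cw_vertex kK; exact: path_related_refl.
apply: (pushout_ind (P := fun x => exists p,
  path_related R (skincl x) (cw_vertex p)) (cw_pushout C n)) => {x}.
  by move=> x; rewrite cw_skel_incl_incl.
move=> [q b]; have [p pP] := ih (@cw_attach _ _ _ C n (q, pole R n)).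
exists p; apply: path_related_trans pP; rewrite -cw_char_incl.
exact: cw_char_path.
Qed.

(** A map w to a discrete set extends over a cell as soon as it is constant on the
boundary. This is assumed for 1-cells and automatic for cells of dimension at
least 2, whose boundary spheres are connected. *)
Lemma cw_extend_discrete (Z : nsetType N) (w : cw_skel C 0 -> discrete_topology Z) :
  nmap w ->
  (forall q s t, w (@cw_attach _ _ _ C 0%N (q, s)) = w (@cw_attach _ _ _ C 0%N (q, t))) ->
  exists2 W : X -> discrete_topology Z, nmap W &
    forall x, W (@cw_skel_incl _ _ _ C 0%N x) = w x.
Proof.
move=> wm wc.
(* the invariant of the recursion: a map that extends over the next cells *)
pose good n (u : cw_skel C n -> discrete_topology Z) := nmap u /\
  forall q s t, u (@cw_attach _ _ _ C n (q, s)) = u (@cw_attach _ _ _ C n (q, t)).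
have step n (u : cw_skel C n -> discrete_topology Z) : good n u ->
    exists u' : cw_skel C n.+1 -> discrete_topology Z,
      good n.+1 u' /\ u' \o @cw_incl _ _ _ C n =1 u.
  move=> [um uc]; have [_ _ _ univ] := cw_pushout C n.
  have [ac ae] := @cw_attach_nmap _ _ _ C n.
  pose v (x : cells (cw_cell C n.+1) (eball R n.+1)) : discrete_topology Z :=
    u (@cw_attach _ _ _ C n (x.1, pole R n)).
  have vm : nmap v.
    split; first by apply: continuous_cells => p; rewrite /v /=; exact: cst_continuous.
    by move=> a [q b]; rewrite /v -(proj2 um) -ae.
  have [|u' [[u'm u'i _] _]] := univ _ u v um vm; first by move=> [q s]; exact: uc.
  exists u'; split=> //; split=> // q s t; apply: (@path_related_discrete R).
  apply: (path_related_map (u := fun s => u' (@cw_attach _ _ _ C n.+1 (q, s)))).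
    move=> z; apply: (@continuous_comp _ _ _ (fun s => @cw_attach _ _ _ C n.+1 (q, s))).
      apply: (continuous_cell (f := @cw_attach _ _ _ C n.+1)).
      by case: (@cw_attach_nmap _ _ _ C n.+1).
    exact: (proj1 u'm).
  exact: sphere_path_connected.
pose u := nat_rect (fun n => {u : cw_skel C n -> discrete_topology Z | good n u})
  (exist (good 0%N) w (conj wm wc))
  (fun n un => let u' := cid (step n (sval un) (svalP un)) in
     exist (good n.+1) (sval u') (proj1 (svalP u'))).
have um n : nmap (sval (u n)) by case: (svalP (u n)).
have ui n : sval (u n.+1) \o @cw_incl _ _ _ C n =1 sval (u n).
  by rewrite /=; case: cid => u' /= [].
have [_ _ univ] := cw_colim C.
have [W [[Wm WE] _]] := univ _ (fun n => sval (u n)) um ui.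
by exists W => // x; exact: (WE 0%N x).
Qed.
End CW.

Section Pullback.
Context (N : monoidType) (P Q T : nsetType N) (u : P -> T) (v : Q -> T).
Hypotheses (ue : equivariant u) (ve : equivariant v).

Definition pullback of equivariant u & equivariant v : Type :=
  {x : P * Q | u x.1 == v x.2}.
Let K := pullback ue ve.
HB.instance Definition _ := Choice.on K.
Fact pullback_act_mem a (x : K) :
  u (nact a (val x).1) == v (nact a (val x).2).
Proof. by rewrite ue ve (eqP (valP x)). Qed.
Definition pullback_act a (x : K) : K :=
  exist (fun x : P * Q => u x.1 == v x.2)
    (nact a (val x).1, nact a (val x).2) (pullback_act_mem a x).
Fact pullback_act1 x : pullback_act 1%g x = x.
Proof. by apply: val_inj; rewrite /= !nact1; case: (val x). Qed.
Fact pullback_actM a b x :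
  pullback_act (a * b)%g x = pullback_act a (pullback_act b x).
Proof. by apply: val_inj; rewrite /= !nactM. Qed.
HB.instance Definition _ := isNSet.Build N K pullback_act1 pullback_actM.

(** Split the projection to P of the pullback of P and Q over T. *)
Lemma nset_projective_lift : nset_projective P -> (forall t, exists q, v q = t) ->
  exists2 h : P -> Q, equivariant h & forall p, v (h p) = u p.
Proof.
move=> projP vs.
pose pr (x : K) : P := (val x).1.
have [||s se sK] := projP K pr.
- by [].
- move=> p; have [q qE] := vs (u p).
  have pq : u (p, q).1 == v (p, q).2 by rewrite /= qE.
  by exists (exist (fun x : P * Q => u x.1 == v x.2) (p, q) pq).
exists (fun p => (val (s p)).2) => [a p|p]; first by rewrite se.
by rewrite -(eqP (valP (s p))); congr u; exact: sK.
Qed.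
End Pullback.

(** S^0 has two points. *)
Lemma finite_esphere1 (R : realType) : finite_set [set: esphere R 1].
Proof.
apply: (@sub_finite_set _ _ [set pole R 0; direction (- delta_mx 0 0 : 'rV[R]_1)]); last first.
  by rewrite finite_setU.
move=> s _; set d : 'rV[R]_1 := delta_mx 0 0.
have E : set_val s = (set_val s 0 0) *: d.
  by apply/rowP => i; rewrite !mxE (ord1 i) mulr1.
have := enorm_sphere s; rewrite {1}E enormZ.
have -> : enorm d = 1 by exact: (enorm_sphere (pole R 0)).
rewrite mulr1 => /eqP; rewrite eqr_norml ler01 andbT => /orP[] /eqP cE.
  by left; apply: val_inj; rewrite -!set_valE E cE scale1r.
by right; rewrite /= -scaleN1r -cE -E directionK.
Qed.

(** Lift the map P_0 -> X -> pi_0(X) = M to h : P_0 -> N. If f' and g' agree at the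
left coordinates of h at the ends of the generating 1-cells, then
p |-> f'(h(p)_1) g'(h(p)_2) takes the same value at both ends of every 1-cell, so
it extends to a locally constant N-map W on X. At a vertex e in the component
of 1, with the left coordinate of h(e) in the dominating set as well, W is 1. Now
(m, 1) e and (1, m) e lie in the component of m, and W sends them to f'(m) and
g'(m). *)
Lemma bi_F1_dominates (R : realType) (M : monoidType) :
  bi_F R 1 M -> exists2 A : set M, finite_set A & dominates A.
Proof.
move=> [X [C [[[f [fe [g [ge fK gK]]]] _] fg]]].
pose N := bimonoid M; pose F : nsetType N := free_nset N unit.
pose cls (x : X) : biset M := f (\pi_(pi0 R X) x).
have cls_act a x : cls (nact a x) = nact a (cls x).
  rewrite /cls -fe; congr f; apply: esym.
  exact: (quot_nactE (@path_related_act R N X)).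
have cls_path x y : path_related R x y <-> cls x = cls y.
  split=> [xy|/(can_inj fK)/eqmodP//].
  by congr f; apply/eqmodP.
pose v (x : F) : biset M := nact x.1 (1%g : biset M).
have ve : equivariant v by exact: (free_nset_lift (fun=> 1%g : biset M)).
have vE n u : v (n, u) = ((n.1 : M) * (n.2 : M))%g.
  by rewrite /v /nact /= /biset_act mulg1.
pose u (p : cw_cell C 0) : biset M := cls (cw_vertex p).
have [i0m _ _] := cw_colim C.
have [[sk0c sk0e] [k [[kc ke] k0 kK]]] := cw_skel0_iso C.
have ue : equivariant u.
  move=> a p; rewrite /u -cls_act; congr cls.
  by rewrite /cw_vertex -(proj2 (i0m 0%N)) -sk0e.
have [h he hE] : exists2 h : cw_cell C 0 -> F, equivariant h &
    forall p, v (h p) = u p.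
  apply: (nset_projective_lift ue ve); first exact: cw_cell_projective.
  by move=> m; exists ((m, 1%g), tt); rewrite vE mulg1.
have [S fS genS] := fg 1%N isT.
pose hk q s := h (k (@cw_attach _ _ _ C 0%N (q, s))).
have [e eE] : exists e, u e = 1%g.
  have [e eP] := cw_path_to_vertex C (repr (g 1%g)).
  exists e; rewrite /u -(proj1 (cls_path _ _) eP) /cls reprK gK; exact.
exists ([set (h e).1.1] `|` \bigcup_(q in S) [set (hk q s).1.1 | s in [set: esphere R 1]]).
  rewrite finite_setU; split; first exact: finite_set1.
  by apply: bigcup_finite => // q _; apply: finite_image; exact: finite_esphere1.
move=> K f' g' fg' m.
pose Z : nsetType N := twisted f' g'.
pose act1 (n : N) : Z := nact n (1%g : Z).
have act1E n : act1 n = (f' n.1 * g' n.2)%g.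
  by rewrite /act1 /nact /= /twisted_act mulg1.
pose w (y : cw_skel C 0) : discrete_topology Z := act1 (h (k y)).1.
have wm : nmap w.
  split.
    move=> y; apply: (@continuous_comp _ (discrete_topology (cw_cell C 0)) _ k
      (fun p => act1 (h p).1 : discrete_topology Z)); first exact: kc.
    exact: continuous_from_discrete.
  by move=> a y; rewrite /w ke he; exact: nactM.
have clsE q s t : cls (@cw_skel_incl _ _ _ C _ (@cw_attach _ _ _ C 0%N (q, s))) =
    cls (@cw_skel_incl _ _ _ C _ (@cw_attach _ _ _ C 0%N (q, t))).
  apply/cls_path; rewrite -!cw_char_incl; exact: cw_char_path.
(* on a generating 1-cell w only depends on the component, by agreement of f' and
   g' at the left coordinate *)
have wgen q s : S q -> w (@cw_attach _ _ _ C 0%N (q, s)) =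
    g' (cls (@cw_skel_incl _ _ _ C _ (@cw_attach _ _ _ C 0%N (q, s)))).
  move=> Sq; rewrite /w -/(hk q s) act1E fg'; last by right; exists q => //; exists s.
  rewrite -gmulfM; congr (g' _).
  have := hE (k (@cw_attach _ _ _ C 0%N (q, s))); rewrite /u /cw_vertex kK => <-.
  by rewrite -/(hk q s); case: (hk q s) => n z; rewrite vE.
have wc q s t : w (@cw_attach _ _ _ C 0%N (q, s)) = w (@cw_attach _ _ _ C 0%N (q, t)).
  have [a [q0 Sq0 ->]] := genS q.
  have aE r : w (@cw_attach _ _ _ C 0%N (nact a q0, r)) =
      nact a (w (@cw_attach _ _ _ C 0%N (q0, r))).
    by rewrite -(proj2 wm) -(proj2 (@cw_attach_nmap _ _ _ C 0%N)).
  by rewrite !aE !wgen // (clsE q0 s t).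
have [W [Wc We] WE] := cw_extend_discrete wm wc.
have We1 : W (cw_vertex e) = (1%g : Z).
  rewrite /cw_vertex WE /w k0 act1E fg'; last by left.
  rewrite -gmulfM.
  by have := hE e; rewrite eE; case: (h e) => n z; rewrite vE => ->; rewrite gmulf1.
have E : cls (nact ((m, 1%g) : N) (cw_vertex e)) =
         cls (nact ((1%g, m) : N) (cw_vertex e)).
  rewrite !cls_act -/(u e) eE.
  by rewrite /nact /= /biset_act /= !mulg1 mul1g.
have := path_related_discrete (path_related_map Wc (proj2 (cls_path _ _) E)).
rewrite !We We1 => E2.
have : (f' m * 1 * g' 1 = f' 1 * 1 * g' m)%g := E2.
by rewrite !gmulf1 !mulg1 mul1g.
Qed.

(** * Adjunction spaces and sequential colimits *)

Section Glue.
Context (N : monoidType) (X : nspaceType N) (P : nsetType N).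
Context (S B : topologicalType) (i : S -> B) (a : cells P S -> X).
Hypotheses (i_inj : injective i) (ci : continuous i) (am : nmap a).

(** The pushout of X and P x B along P x S, as the disjoint union of X and of the
part of P x B outside P x S, with the finest topology that makes the two
canonical maps continuous. The proofs are parameters of the type so that it can
carry the N-space structure. *)
Definition adjoin of injective i & continuous i & nmap a : Type :=
  (X + {x : cells P B | `[< ~ exists s, i s = x.2 >]})%type.
Let Y := adjoin i_inj ci am.
HB.instance Definition _ := gen_eqMixin Y.
HB.instance Definition _ := gen_choiceMixin Y.

Definition adjoin_base (x : X) : Y := inl x.
Definition adjoin_cell (x : cells P B) : Y :=
  match pselect (exists s, i s = x.2) with
  | left e => inl (a (x.1, sval (cid e)))
  | right ne => inr (exist (fun x : cells P B => `[< ~ exists s, i s = x.2 >])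
      x (asboolT ne))
  end.

Lemma adjoin_cell_incl x : adjoin_cell (cells_map i x) = adjoin_base (a x).
Proof.
case: x => p s; rewrite /adjoin_cell /=; case: pselect => [e|[]]; last by exists s.
by congr (inl (a (_, _))); apply: i_inj; case: (cid e).
Qed.

Lemma adjoin_cell_new x : ~ (exists s, i s = x.2) ->
  exists H, adjoin_cell x =
    inr (exist (fun x : cells P B => `[< ~ exists s, i s = x.2 >]) x H).
Proof.
by move=> nx; rewrite /adjoin_cell; case: pselect => // ne; exists (asboolT ne).
Qed.

Lemma adjoin_cover (y : Y) : (exists x, y = adjoin_base x) \/ (exists c, y = adjoin_cell c).
Proof.
case: y => [x|[c H]]; [by left; exists x|right; exists c].
have /asboolP nc := H; have [H' ->] := adjoin_cell_new nc.
by congr (inr (exist _ _ _)); exact: bool_irrelevance.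
Qed.

Let op : set_system Y :=
  [set U | open (adjoin_base @^-1` U) /\ open (adjoin_cell @^-1` U)].
Let opT : op setT. Proof. by split; exact: openT. Qed.
Let opI : setI_closed op.
Proof. by move=> U V [? ?] [? ?]; split; rewrite preimage_setI; exact: openI. Qed.
Let op_bigU (I : Type) (f : I -> set Y) :
  (forall k, op (f k)) -> op (\bigcup_k f k).
Proof.
move=> fop; split; rewrite preimage_bigcup; apply: bigcup_open => k _;
  by case: (fop k).
Qed.
HB.instance Definition _ := isOpenTopological.Build Y opT opI op_bigU.

Lemma adjoin_continuous (Z : topologicalType) (h : Y -> Z) :
  continuous (h \o adjoin_base) -> continuous (h \o adjoin_cell) -> continuous h.
Proof.
by move=> /continuousP hb /continuousP hc; apply/continuousP => U oU;
  split; [exact: hb|exact: hc].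
Qed.
Lemma adjoin_base_continuous : continuous adjoin_base.
Proof. by apply/continuousP => U []. Qed.
Lemma adjoin_cell_continuous : continuous adjoin_cell.
Proof. by apply/continuousP => U []. Qed.

(** Without assumptions on u and v this map ignores v on P x S; it restricts to v
there when u and v are compatible. *)
Definition adjoin_map (Z : Type) (u : X -> Z) (v : cells P B -> Z) (y : Y) : Z :=
  match y with inl x => u x | inr c => v (val c) end.

Lemma adjoin_map_cell (Z : Type) (u : X -> Z) (v : cells P B -> Z) :
  (forall x, u (a x) = v (cells_map i x)) ->
  forall c, adjoin_map u v (adjoin_cell c) = v c.
Proof.
move=> uv [p b]; have [[s <-]|nb] := pselect (exists s, i s = b).
  by rewrite -[(p, i s)]/(cells_map i (p, s)) adjoin_cell_incl /= uv.
by have [H ->] := adjoin_cell_new (x := (p, b)) nb.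
Qed.

Lemma adjoin_map_continuous (Z : topologicalType) (u : X -> Z) (v : cells P B -> Z) :
  continuous u -> continuous v -> (forall x, u (a x) = v (cells_map i x)) ->
  continuous (adjoin_map u v).
Proof.
move=> cu cv uv; apply: adjoin_continuous => //.
by rewrite (_ : _ \o _ = v) //; apply/funext => c; exact: adjoin_map_cell.
Qed.

Definition adjoin_act (b : N) : Y -> Y :=
  adjoin_map (fun x => adjoin_base (nact b x)) (fun c => adjoin_cell (nact b c)).

Lemma adjoin_act_cell b c : adjoin_act b (adjoin_cell c) = adjoin_cell (nact b c).
Proof.
apply: adjoin_map_cell => x; rewrite -(proj2 am) -adjoin_cell_incl.
by congr adjoin_cell.
Qed.

Fact adjoin_act1 y : adjoin_act 1%g y = y.
Proof.
case: (adjoin_cover y) => [[x ->]|[c ->]]; last by rewrite adjoin_act_cell nact1.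
by rewrite /adjoin_act /= nact1.
Qed.
Fact adjoin_actM b c y : adjoin_act (b * c)%g y = adjoin_act b (adjoin_act c y).
Proof.
case: (adjoin_cover y) => [[x ->]|[d ->]]; last by rewrite !adjoin_act_cell nactM.
by rewrite /adjoin_act /= nactM.
Qed.
HB.instance Definition _ := isNSet.Build N Y adjoin_act1 adjoin_actM.
Fact adjoin_act_continuous :
  continuous (fun p : discrete_topology N * Y => nact p.1 p.2).
Proof.
apply: discrete_prod_continuous => b; apply: adjoin_map_continuous.
- move=> x; apply: (@continuous_comp _ _ _ (nact b)); first exact: nact_continuous1.
  exact: adjoin_base_continuous.
- move=> x; apply: (@continuous_comp _ _ _ (nact b)); first exact: nact_continuous1.
  exact: adjoin_cell_continuous.
- by move=> x; rewrite -(proj2 am) -adjoin_cell_incl; congr adjoin_cell.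
Qed.
HB.instance Definition _ := NSet_isNSpace.Build N Y adjoin_act_continuous.

Lemma adjoin_base_nmap : nmap (adjoin_base : X -> Y).
Proof. by split; first exact: adjoin_base_continuous. Qed.
Lemma adjoin_cell_nmap : nmap (adjoin_cell : cells P B -> Y).
Proof.
by split=> [|b c]; [exact: adjoin_cell_continuous|rewrite -adjoin_act_cell].
Qed.

Lemma adjoin_pushout : is_nspace_pushout (cells_map i) a
  (adjoin_base : X -> Y) (adjoin_cell : cells P B -> Y).
Proof.
split; [exact: adjoin_base_nmap|exact: adjoin_cell_nmap| |].
  by move=> x; rewrite /= adjoin_cell_incl.
move=> Z u v um vm uv.
exists (adjoin_map u v); split.
  split=> // [|c]; last exact: adjoin_map_cell.
  split; first exact: adjoin_map_continuous (proj1 um) (proj1 vm) _.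
  move=> b y; case: (adjoin_cover y) => [[x ->]|[c ->]].
    exact: (proj2 um).
  rewrite -[nact b _]/(adjoin_act b _) adjoin_act_cell !adjoin_map_cell //.
  exact: (proj2 vm).
move=> h [hm hu hv]; apply/funext => y.
case: (adjoin_cover y) => [[x ->]|[c ->]]; first exact: esym (hu x).
by rewrite adjoin_map_cell //; exact: esym (hv c).
Qed.

Lemma adjoin_base_inj : injective (adjoin_base : X -> Y).
Proof. by move=> x y []. Qed.
End Glue.

Section Colim.
Context (N : monoidType) (X : nat -> nspaceType N) (i : forall n, X n -> X n.+1).
Hypotheses (im : forall n, nmap (@i n)) (i_inj : forall n, injective (@i n)).

Definition fresh n : X n -> bool :=
  match n with
  | 0%N => fun=> true
  | n'.+1 => fun y : X n'.+1 => `[< ~ exists x, i x = y >]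
  end.
(** The colimit of a sequence of injections, as the disjoint union over n of the
part of X n that is not in the image of X (n - 1), with the finest topology that
makes the maps from all X n continuous. *)
Definition colim of (forall n, nmap (@i n)) & (forall n, injective (@i n)) : Type :=
  {n & {x : X n | fresh x}}.
Let Y := colim im i_inj.
HB.instance Definition _ := gen_eqMixin Y.
HB.instance Definition _ := gen_choiceMixin Y.

Definition colim_mk n (x : X n) (H : fresh x) : Y :=
  existT (fun n => {x : X n | fresh x}) n (exist (fun x => fresh x) x H).

Fixpoint colim_in n : X n -> Y :=
  match n return X n -> Y with
  | 0%N => fun x => @colim_mk 0%N x isT
  | n'.+1 => fun y =>
    match pselect (exists x, i x = y) with
    | left e => colim_in (sval (cid e))
    | right ne => @colim_mk n'.+1 y (asboolT ne)
    end
  end.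

Lemma colim_in_incl n (x : X n) : colim_in (i x) = colim_in x :> Y.
Proof.
rewrite /=; case: pselect => [e|[]]; last by exists x.
by congr colim_in; apply: i_inj; case: (cid e).
Qed.

Lemma colim_in_fresh n (x : X n) (H : fresh x) : colim_in x = colim_mk H.
Proof.
case: n x H => [|n] x H /=; first by rewrite (bool_irrelevance H isT).
have /asboolP nx := H; case: pselect => // ne.
by rewrite (bool_irrelevance H (asboolT ne)).
Qed.

Lemma colim_cover (y : Y) : exists n (x : X n), y = colim_in x.
Proof. by case: y => n [x H]; exists n, x; rewrite colim_in_fresh. Qed.

Let op : set_system Y := [set U | forall n, open (@colim_in n @^-1` U)].
Let opT : op setT. Proof. by move=> n; exact: openT. Qed.
Let opI : setI_closed op.
Proof. by move=> U V oU oV n; rewrite preimage_setI; exact: openI. Qed.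
Let op_bigU (I : Type) (f : I -> set Y) :
  (forall k, op (f k)) -> op (\bigcup_k f k).
Proof.
by move=> fop n; rewrite preimage_bigcup; apply: bigcup_open => k _; exact: fop.
Qed.
HB.instance Definition _ := isOpenTopological.Build Y opT opI op_bigU.

Lemma colim_continuous (Z : topologicalType) (h : Y -> Z) :
  (forall n, continuous (h \o @colim_in n)) -> continuous h.
Proof.
move=> hc; apply/continuousP => U oU.
have H n : open (@colim_in n @^-1` (h @^-1` U)).
  exact: (proj1 (continuousP (h \o @colim_in n)) (hc n) U oU).
exact: H.
Qed.
Lemma colim_in_continuous n : continuous (@colim_in n).
Proof. by apply/continuousP => U; exact. Qed.

Definition colim_map (Z : Type) (u : forall n, X n -> Z) (y : Y) : Z :=
  u (tag y) (val (tagged y)).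

Lemma colim_map_in (Z : Type) (u : forall n, X n -> Z) :
  (forall n x, u n.+1 (i x) = u n x) ->
  forall n (x : X n), colim_map u (colim_in x) = u n x.
Proof.
move=> ui; elim=> // n ih x /=; case: pselect => // e.
by rewrite ih -ui; case: (cid e) => z /= ->.
Qed.

Lemma colim_map_continuous (Z : topologicalType) (u : forall n, X n -> Z) :
  (forall n, continuous (u n)) -> (forall n x, u n.+1 (i x) = u n x) ->
  continuous (colim_map u).
Proof.
move=> cu ui; apply: colim_continuous => n.
by rewrite (_ : _ \o _ = u n) //; apply/funext => x; exact: colim_map_in.
Qed.

Definition colim_act (b : N) : Y -> Y :=
  colim_map (fun n x => colim_in (nact b x)).

Lemma colim_act_in b n (x : X n) : colim_act b (colim_in x) = colim_in (nact b x).
Proof.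
by apply: (colim_map_in (u := fun n x => colim_in (nact b x))) => {}n {}x;
  rewrite -(proj2 (im n)) colim_in_incl.
Qed.
Fact colim_act1 y : colim_act 1%g y = y.
Proof. by have [n [x ->]] := colim_cover y; rewrite colim_act_in nact1. Qed.
Fact colim_actM b c y : colim_act (b * c)%g y = colim_act b (colim_act c y).
Proof. by have [n [x ->]] := colim_cover y; rewrite !colim_act_in nactM. Qed.
HB.instance Definition _ := isNSet.Build N Y colim_act1 colim_actM.
Fact colim_act_continuous :
  continuous (fun p : discrete_topology N * Y => nact p.1 p.2).
Proof.
apply: discrete_prod_continuous => b.
apply: (colim_map_continuous (u := fun n (x : X n) => colim_in (nact b x))).
  move=> n x; apply: (@continuous_comp _ _ _ (nact b)); first exact: nact_continuous1.
  exact: colim_in_continuous.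
by move=> n x; rewrite -(proj2 (im n)) colim_in_incl.
Qed.
HB.instance Definition _ := NSet_isNSpace.Build N Y colim_act_continuous.

Lemma colim_in_nmap n : nmap (@colim_in n : X n -> Y).
Proof.
by split=> [|b x]; [exact: colim_in_continuous|rewrite -colim_act_in].
Qed.

Lemma colim_universal : is_nspace_colim i (fun n => @colim_in n : X n -> Y).
Proof.
split; [exact: colim_in_nmap|exact: colim_in_incl|].
move=> Z u um ui; exists (colim_map u); split.
  split=> [|n x]; last exact: colim_map_in.
  split; first by apply: colim_map_continuous => // n; case: (um n).
  move=> b y; have [n [x ->]] := colim_cover y.
  rewrite -[nact b _]/(colim_act b _) colim_act_in !colim_map_in //.
  exact: (proj2 (um n)).
move=> h [hm hu]; apply/funext => y; have [n [x ->]] := colim_cover y.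
by rewrite colim_map_in //; exact: esym (hu n x).
Qed.
End Colim.

(** * A complex in which all spheres are filled *)

Section FreeAttach.
Context (N : monoidType) (X : nspaceType N) (S : topologicalType) (I : choiceType).
Context (phi : I -> S -> X).

(** The attaching map of one free orbit of cells for every map in the family phi. *)
Definition free_attach (x : cells (free_nset N I) S) : X :=
  nact x.1.1 (phi x.1.2 x.2).

Lemma free_attach_nmap : (forall k, continuous (phi k)) -> nmap free_attach.
Proof.
move=> cphi; split; last by move=> b [[n k] s]; exact: nactM.
apply: continuous_cells => -[n k] s.
apply: (@continuous_comp _ _ _ (phi k) (nact n)); first exact: cphi.
exact: nact_continuous1.
Qed.
End FreeAttach.

Section Tower.
Context (R : realType) (M : monoidType) (A : set M).
Notation N := (bimonoid M).
Notation V := (free_nset N unit).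

Definition vtx (m m' : M) : discrete_topology V := (((m, m') : N), tt).

(** A skeleton together with its vertices, which are needed to describe the
attaching maps of the edges. *)
Record stage := Stage {
  stage_space :> nspaceType N;
  stage_vertex : discrete_topology V -> stage_space
}.

(** S^0 is the set of points 1 and -1, where 1 is the target and -1 the source of the
edge (1, 1, a). *)
Definition edge_ends (T : stage) (a : M) (s : esphere R 1) : T :=
  stage_vertex T (if 0 < set_val s 0 0 then vtx a 1%g else vtx 1%g a).

Lemma edge_ends_continuous T a : continuous (edge_ends T a).
Proof.
move=> s.
apply: (@continuous_comp _ (discrete_topology V) _
  (fun s : esphere R 1 => if 0 < set_val s 0 0 then vtx a 1%g else vtx 1%g a)
  (@stage_vertex T)); last exact: continuous_from_discrete.
apply: continuous_to_discrete => {}s /=.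
have cx : continuous (fun s : esphere R 1 => set_val s 0 0).
  move=> z; apply: (@continuous_comp _ 'rV[R]_1 _ set_val (fun x => x 0 0)).
    exact: set_val_continuous.
  exact: coord_row_continuous.
have oc (D : set R) : open D -> open [set z : esphere R 1 | D (set_val z 0 0)].
  move=> oD; apply: (open_comp (f := fun s : esphere R 1 => set_val s 0 0) _ oD).
  by move=> z _; exact: cx.
have [s0|s0] := ltrP 0 (set_val s 0 0).
  have : nbhs s [set z : esphere R 1 | 0 < set_val z 0 0].
    by apply: open_nbhs_nbhs; split=> //; apply: (oc [set r | 0 < r]); exact: open_gt.
  by apply: filterS => z /= ->.
have s1 : set_val s 0 0 < 0.
  rewrite lt_neqAle s0 andbT; apply/eqP => E; have := sphere_neq0 s.
  by case/eqP; apply/rowP => k; rewrite (ord1 k) mxE.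
have : nbhs s [set z : esphere R 1 | set_val z 0 0 < 0].
  by apply: open_nbhs_nbhs; split=> //; apply: (oc [set r | r < 0]); exact: open_lt.
by apply: filterS => z /= z0; rewrite ltNge (ltW z0).
Qed.

(** Indices of the orbits of (n+1)-cells to be attached to the n-skeleton T: the
elements of A for n = 0, all maps S^n -> T for n > 0. *)
Definition cell_index (n : nat) (T : stage) : choiceType :=
  match n with
  | 0%N => A
  | n'.+1 => continuousType (esphere R n'.+2) T
  end.

Definition cell_sphere n (T : stage) : cell_index n T -> esphere R n.+1 -> T :=
  match n return cell_index n T -> esphere R n.+1 -> T with
  | 0%N => fun a : A => edge_ends T (set_val a)
  | n'.+1 => fun f => f
  end.

Lemma cell_sphere_continuous n T k : continuous (@cell_sphere n T k).
Proof. by case: n k => [|n] k; [exact: edge_ends_continuous|exact: cts_fun]. Qed.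

Lemma esphere_incl_inj n : injective (@esphere_incl R n).
Proof. by move=> s t /(congr1 val) /= st; apply: val_inj. Qed.

Definition stage_attach n (T : stage) := free_attach (@cell_sphere n T).

Definition next_space n (T : stage) : nspaceType N :=
  adjoin (@esphere_incl_inj n.+1) (@esphere_incl_continuous R n.+1)
    (free_attach_nmap (@cell_sphere_continuous n T)).

Definition stage_base n (T : stage) : T -> next_space n T :=
  @adjoin_base _ _ _ _ _ _ _ (@esphere_incl_inj n.+1)
    (@esphere_incl_continuous R n.+1)
    (free_attach_nmap (@cell_sphere_continuous n T)).

Definition stage_cell n (T : stage) :
  cells (free_nset N (cell_index n T)) (eball R n.+1) -> next_space n T :=
  @adjoin_cell _ _ _ _ _ _ _ (@esphere_incl_inj n.+1)
    (@esphere_incl_continuous R n.+1)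
    (free_attach_nmap (@cell_sphere_continuous n T)).

Fixpoint tower (n : nat) : stage :=
  match n with
  | 0%N => @Stage (discrete_topology V) id
  | n'.+1 => @Stage (next_space n' (tower n'))
              (@stage_base n' (tower n') \o @stage_vertex (tower n'))
  end.

Definition tower_base n : tower n -> tower n.+1 := @stage_base n (tower n).
Definition tower_cell n :
  cells (free_nset N (cell_index n (tower n))) (eball R n.+1) -> tower n.+1 :=
  @stage_cell n (tower n).

Lemma tower_pushout n : is_nspace_pushout (cells_map (@esphere_incl R n.+1))
  (@stage_attach n (tower n)) (@tower_base n) (@tower_cell n).
Proof. exact: adjoin_pushout. Qed.

Lemma tower_base_nmap n : nmap (@tower_base n).
Proof. exact: adjoin_base_nmap. Qed.
Lemma tower_base_inj n : injective (@tower_base n).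
Proof. exact: adjoin_base_inj. Qed.

Definition bicomplex : nspaceType N := colim tower_base_nmap tower_base_inj.

Definition bicomplex_cell (n : nat) : nsetType N :=
  if n is n'.+1 then free_nset N (cell_index n' (tower n')) else V.

Lemma bicomplex_cell_projective n : nset_projective (bicomplex_cell n).
Proof. by case: n => [|n]; exact: free_nset_projective. Qed.

Lemma skel0_iso : is_nspace_iso (id : discrete_topology (bicomplex_cell 0) -> tower 0).
Proof.
have idm : nmap (id : discrete_topology V -> discrete_topology V).
  by split=> // x; exact: continuous_from_discrete.
by split=> //; exists id.
Qed.

Definition bicomplex_cw : projective_cw R bicomplex :=
  @ProjectiveCW R N bicomplex bicomplex_cell bicomplex_cell_projective
    (fun n => tower n) id skel0_iso
    (fun n => @stage_attach n (tower n))
    (fun n => free_attach_nmap (@cell_sphere_continuous n (tower n)))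
    tower_base tower_cell tower_pushout
    (fun n => @colim_in _ _ _ tower_base_nmap tower_base_inj n)
    (colim_universal tower_base_nmap tower_base_inj).

Lemma bicomplex_cell_fg n : finite_set A -> (n <= 1)%N -> nset_fg (bicomplex_cell n).
Proof.
move=> fA; case: n => [|[|//]] _; apply: free_nset_fg; first exact: finite_finset.
by rewrite (eq_finite_set (card_setT A)).
Qed.

(** A map phi of a sphere is filled by the cell with index (1, phi). *)
Lemma tower_extends_spheres n : @extends_spheres R _ _ (@tower_base n.+1) n.+2.
Proof.
move=> phi cphi.
pose H := isContinuous.Build _ _ phi cphi.
pose f : continuousType (esphere R n.+2) (tower n.+1) := HB.pack phi H.
exists (fun b => @tower_cell n.+1 ((1%g, f), b)).
  apply: (continuous_cell (f := @tower_cell n.+1)); exact: adjoin_cell_continuous.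
move=> s; have [_ _ E _] := tower_pushout n.+1.
pose c : cells (free_nset N (cell_index n.+1 (tower n.+1))) (esphere R n.+2) :=
  ((1%g, f), s).
apply: etrans (esym (E c)) _; congr tower_base; exact: nact1.
Qed.
End Tower.

(** * Contraction of the components *)

Section Contraction.
Context (R : realType) (M : monoidType) (A : set M).
Hypothesis pi0A : is_nset_iso (@cayley_pi0_map M A).
Notation N := (bimonoid M).
Notation T := (tower R A).
Notation base := (@tower_base R M A _).
Notation cell := (@tower_cell R M A _).
Notation X := (bicomplex R A).
Notation into := (@colim_in _ _ _ (@tower_base_nmap R M A) (@tower_base_inj R M A) _).

Definition tower_vertex n (m m' : M) : T n := stage_vertex (T n) (vtx m m').

Lemma into_base n (x : T n) : into (base x) = into x.
Proof. exact: colim_in_incl. Qed.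

Lemma into_continuous n :
  continuous (@colim_in _ _ _ (@tower_base_nmap R M A) (@tower_base_inj R M A) n).
Proof. exact: colim_in_continuous. Qed.

Lemma into_vertex n m m' : into (tower_vertex n m m') = into (tower_vertex 0 m m').
Proof. by elim: n => // n <-; exact: into_base. Qed.

Lemma vtx_act (m m' a b : M) :
  nact ((m, m') : N) (vtx a b) = vtx (m * a)%g (b * m')%g.
Proof. by []. Qed.

(** An edge of the digraph is traversed by the corresponding 1-cell. *)
Lemma vertex_path (v w : cayley_vertex M) :
  joined (G := two_sided_cayley A) v w ->
  path_related R (tower_vertex 1 v.1 v.2) (tower_vertex 1 w.1 w.2).
Proof.
move=> /asboolP; elim=> {v w}
  [v w [[[m m'] a] /= [<- <-]]|v|v w _ vw|u v w _ uv _ vw].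
- pose q : free_nset N (@cell_index R M A 0 (T 0%N)) := ((m, m') : N, a).
  pose c s : cells (free_nset N (@cell_index R M A 0 (T 0%N))) (esphere R 1) := (q, s).
  have cE s : cell (q, esphere_incl s) = base (stage_attach (c s)).
    by have [_ _ E _] := @tower_pushout R M A 0; exact: esym (E (c s)).
  pose sm : esphere R 1 := direction (- delta_mx 0 0).
  have d0 : - delta_mx 0 0 != 0 :> 'rV[R]_1.
    by rewrite oppr_eq0; exact: sphere_neq0 (pole R 0).
  have smE : (0 < set_val sm 0 0) = false.
    rewrite val_direction // !mxE /= mulrN1 oppr_gt0; apply/negbTE.
    by rewrite -leNgt invr_ge0 enorm_ge0.
  have spE : 0 < set_val (pole R 0) 0 0 by rewrite set_valE /= mxE ltr01.
  have -> : tower_vertex 1 m (val a * m')%g = cell (q, esphere_incl sm).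
    rewrite cE /stage_attach /free_attach /= /edge_ends smE.
    by rewrite [nact _ _](vtx_act m m' 1%g (val a)) mulg1.
  have -> : tower_vertex 1 (m * val a)%g m' = cell (q, esphere_incl (pole R 0)).
    rewrite cE /stage_attach /free_attach /= /edge_ends spE.
    by rewrite [nact _ _](vtx_act m m' (val a) 1%g) mul1g.
  apply: (path_related_map (u := fun b => cell (q, b))).
    apply: (continuous_cell (f := @tower_cell R M A 0)).
    exact: adjoin_cell_continuous.
  exact: ball_path_connected.
- exact: path_related_refl.
- by rewrite path_related_sym.
- exact: path_related_trans vw.
Qed.

(** The product of the coordinates of a vertex extends to a locally constant map,
because both ends of an edge have the same product. *)
Lemma class_map : exists2 W : X -> discrete_topology (biset M), nmap W &
  forall m m', W (into (tower_vertex 0 m m')) = (m * m')%g.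
Proof.
pose w (v : T 0%N) : discrete_topology (biset M) := ((v.1.1 : M) * (v.1.2 : M))%g.
have wm : nmap w.
  split; first exact: continuous_from_discrete.
  move=> [b b'] [[m m'] u].
  have : ((b * m) * ((m' : M) * b') = b * (m * m') * b')%g by rewrite !mulgA.
  exact.
have [q s t|W Wm WE] := @cw_extend_discrete R N X (bicomplex_cw R A) (biset M) w wm.
  have E r : w (cw_attach (p := bicomplex_cw R A) (q, r)) =
      nact q.1 (val q.2 : biset M).
    rewrite (proj2 wm); congr nact.
    rewrite /= /edge_ends /=; case: ifP => _; rewrite /w /=.
      by rewrite mulg1.
    by rewrite mul1g.
  by rewrite !E.
by exists W => // m m'; rewrite WE.
Qed.


Section Homotopy.
Context (W : X -> discrete_topology (biset M)) (Wm : nmap W).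
Hypothesis WE : forall m m', W (into (tower_vertex 0 m m')) = (m * m')%g.

(** Homotopies are parametrized by the whole line, with the times outside [0, 1]
moved to the nearest end. *)
Definition unit_clamp (t : R) : R := set_val (clamp t).
Lemma unit_clamp_continuous : continuous unit_clamp.
Proof.
move=> t; apply: (@continuous_comp _ _ _ (@clamp R)); first exact: clamp_continuous.
exact: set_val_continuous.
Qed.
Lemma unit_clamp_itv t : 0 <= unit_clamp t <= 1.
Proof. by have := set_valP (clamp t); rewrite /= in_itv. Qed.
Lemma unit_clamp_id t : unit_clamp (unit_clamp t) = unit_clamp t.
Proof. by rewrite /unit_clamp clampK. Qed.
Lemma unit_clamp0 : unit_clamp 0 = 0. Proof. by rewrite /unit_clamp val_clamp_id // lexx ler01. Qed.
Lemma unit_clamp1 : unit_clamp 1 = 1. Proof. by rewrite /unit_clamp val_clamp_id // lexx ler01. Qed.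

(** With [continuous_curryR], maps Y x R -> Z correspond to maps from Y to the
function space, because R is locally compact. So a homotopy on a pushout or
colimit can be defined by the universal property of the space alone, without
knowing that its product with R is again a pushout or colimit. *)
Lemma continuous_uncurryR (Y Z : topologicalType) (f : Y -> R -> Z) :
  continuous (f : Y -> {compact-open, R -> Z}) -> (forall y, continuous (f y)) ->
  continuous (fun p : Y * R => f p.1 p.2).
Proof.
move=> cf cfy; have -> : (fun p : Y * R => f p.1 p.2) = uncurry f.
  by apply/funext => -[].
by apply: continuous_uncurry => //; exact: locally_compactR.
Qed.

Lemma continuous_curryR (Y Z : topologicalType) (f : Y * R -> Z) :
  continuous f -> continuous ((fun y t => f (y, t)) : Y -> {compact-open, R -> Z}).
Proof. exact: continuous_curry_fun. Qed.

Lemma continuous_reparam (Y Z : topologicalType) (f : Y * R -> Z) :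
  continuous f -> continuous (fun p : Y * R => f (p.1, unit_clamp p.2)).
Proof.
move=> cf p; apply: (@continuous_comp _ (Y * R)%type _ (fun p : Y * R => (p.1, unit_clamp p.2))).
  apply: continuous_pair; first exact: cvg_fst.
  apply: (@continuous_comp _ _ _ snd); [exact: cvg_snd|exact: unit_clamp_continuous].
exact: cf.
Qed.

Lemma continuous_slice (Y Z : topologicalType) (f : Y * R -> Z) y :
  continuous f -> continuous (fun t => f (y, t)).
Proof.
move=> cf t; apply: (@continuous_comp _ _ _ (fun t => (y, t))); last exact: cf.
by apply: continuous_pair; [exact: cst_continuous|exact: cvg_id].
Qed.

(** A homotopy from the inclusion of the n-skeleton to the map that sends a point
of the component m to the vertex (1, m), with values one dimension higher. *)
Definition pushes_to_base n (H : T n * R -> T n.+1) : Prop :=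
  [/\ continuous H, forall x, H (x, 0) = base x &
    forall x, H (x, 1) = tower_vertex n.+1 1%g (W (into x))].

Lemma push_to_base0 : exists H, @pushes_to_base 0 H.
Proof.
have pathE (x : T 0%N) : exists f : R -> T 1%N,
    [/\ continuous f, f 0 = base x & f 1 = tower_vertex 1 1%g (W (into x))].
  case: x => -[m m'] []; apply/path_relatedP.
  rewrite (WE m m'); exact: (vertex_path (pi0_iso_joined (m, m') pi0A)).
pose f x := sval (cid (pathE x)).
exists (fun p => f p.1 p.2); split.
- apply: (@continuous_cells (free_nset N unit) R) => x.
  by rewrite /f /=; case: cid => g /= [].
- by move=> x; rewrite /f /=; case: cid => g /= [].
- by move=> x; rewrite /f /=; case: cid => g /= [].
Qed.

(** On a cell p the extension is prescribed on the bottom (inclusion of the cell), the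
top (a vertex, the same for the whole cell, which is connected) and the side
(the given homotopy); [extend_cylinder] fills the cylinder one dimension higher. *)
Lemma push_to_base_step n (H : T n * R -> T n.+1) : pushes_to_base H ->
  exists H', @pushes_to_base n.+1 H' /\
    forall x t, H' (base x, t) = base (H (x, unit_clamp t)).
Proof.
move=> [cH H0 H1].
have cbase k : continuous (@tower_base R M A k) by case: (@tower_base_nmap R M A k).
have ccell k : continuous (@tower_cell R M A k) by exact: adjoin_cell_continuous.
have [_ _ pushE _] := @tower_pushout R M A n.
have cattach := proj1 (free_attach_nmap (@cell_sphere_continuous R M A n (T n))).
have Wcell p b b' : W (into (@tower_cell R M A n (p, b))) =
    W (into (@tower_cell R M A n (p, b'))).
  apply: (@path_related_discrete R).
  apply: (path_related_map (u := fun b => W (into (@tower_cell R M A n (p, b))))).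
    move=> c.
    have c1 : continuous (fun b => @tower_cell R M A n (p, b)) := continuous_cell (ccell n).
    have c2 : continuous (fun y : T n.+1 => W (into y)).
      move=> y; exact: (continuous_comp (@into_continuous n.+1 y) (proj1 Wm _)).
    exact: (continuous_comp (c1 c) (c2 _)).
  exact: ball_path_connected.
pose c p := tower_vertex n.+1 1%g
  (W (into (@tower_cell R M A n (p, esphere_incl (pole R n))))).
have cylE p : exists G : eball R n.+1 * R -> T n.+2,
    [/\ continuous G, forall b, G (b, 0) = base (@tower_cell R M A n (p, b)),
      forall b, G (b, 1) = base (c p) &
      forall s t, 0 <= t <= 1 ->
        G (esphere_incl s, t) = base (H (@stage_attach R M A n (T n) (p, s), t))].
  apply: (extend_cylinder (g := fun b => @tower_cell R M A n (p, b))
    (h := fun q => H (@stage_attach R M A n (T n) (p, q.1), q.2))).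
  - exact: tower_extends_spheres.
  - exact: (continuous_cell (ccell n)).
  - move=> q; apply: (@continuous_comp _ (T n * R)%type _
      (fun q => (@stage_attach R M A n (T n) (p, q.1), q.2))); last exact: cH.
    apply: continuous_pair; last exact: cvg_snd.
    apply: (@continuous_comp _ _ _ fst (fun s => @stage_attach R M A n (T n) (p, s))).
      exact: cvg_fst.
    exact: (continuous_cell cattach).
  - by move=> s; rewrite H0; exact: (pushE (p, s)).
  - move=> s; rewrite H1 -into_base /c.
    rewrite (Wcell p (esphere_incl (pole R n)) (esphere_incl s)).
    by congr (tower_vertex _ _ (W (into _))); exact: (pushE (p, s)).
pose G p := sval (cid (cylE p)).
have GE p : [/\ continuous (G p), forall b, G p (b, 0) = base (@tower_cell R M A n (p, b)),
      forall b, G p (b, 1) = base (c p) &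
      forall s t, 0 <= t <= 1 ->
        G p (esphere_incl s, t) = base (H (@stage_attach R M A n (T n) (p, s), t))].
  exact: (svalP (cid (cylE p))).
pose u (x : T n) : R -> T n.+2 := fun t => base (H (x, unit_clamp t)).
pose v (q : cells (free_nset N (cell_index R A n (T n))) (eball R n.+1)) : R -> T n.+2 :=
  fun t => G q.1 (q.2, unit_clamp t).
have uv x : u (@stage_attach R M A n (T n) x) = v (cells_map (@esphere_incl R n.+1) x).
  case: x => p s; apply/funext => t; rewrite /u /v /=.
  by have [_ _ _ ->] := GE p; last exact: unit_clamp_itv.
have cu2 : continuous (fun p : T n * R => u p.1 p.2).
  apply: (@continuous_reparam _ _ (base \o H)) => p.
  by apply: continuous_comp; [exact: cH|exact: cbase].
have cv2 p : continuous (fun q : eball R n.+1 * R => v (p, q.1) q.2).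
  by apply: (@continuous_reparam _ _ (G p)); case: (GE p).
pose K : T n.+1 -> R -> T n.+2 := adjoin_map u v.
have K_cell q : K (@tower_cell R M A n q) = v q by exact: adjoin_map_cell.
have cK : continuous (K : T n.+1 -> {compact-open, R -> T n.+2}).
  apply: (@adjoin_map_continuous _ _ _ _ _ _ _ _ _ _ {compact-open, R -> T n.+2}) => //.
    exact: (continuous_curryR cu2).
  apply: continuous_cells => p; exact: (continuous_curryR (cv2 p)).
have cKy y : continuous (K y).
  case: (adjoin_cover y) => [[x ->]|[[p b] ->]].
    have cux : continuous (u x) :=
      @continuous_slice _ _ (fun p : T n * R => u p.1 p.2) x cu2.
    exact: cux.
  rewrite [K _]K_cell.
  have cvb : continuous (v (p, b)) :=
    @continuous_slice _ _ (fun q : eball R n.+1 * R => v (p, q.1) q.2) b (cv2 p).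
  exact: cvb.
exists (fun p => K p.1 p.2); split=> //; split.
- exact: continuous_uncurryR.
- move=> y; case: (adjoin_cover y) => [[x ->]|[[p b] ->]] /=.
    by rewrite /u unit_clamp0 H0.
  by rewrite [K _]K_cell /v /= unit_clamp0; have [_ -> _ _] := GE p.
- move=> y; case: (adjoin_cover y) => [[x ->]|[[p b] ->]] /=.
    rewrite /u unit_clamp1 H1.
    exact: (congr1 (fun z => base (tower_vertex n.+1 1%g (W z))) (esym (into_base x))).
  rewrite [K _]K_cell /v /= unit_clamp1; have [_ _ -> _] := GE p.
  exact: (congr1 (fun z => base (tower_vertex n.+1 1%g z)) (Wcell p _ b)).
Qed.

(** The homotopies of the skeleta are compatible, hence define one on the colimit. *)
Lemma bicomplex_contraction : exists H : X * R -> X,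
  [/\ continuous H, forall x, H (x, 0) = x &
    forall x, H (x, 1) = into (tower_vertex 0 1%g (W x))].
Proof.
have [H0 H0m] := push_to_base0.
pose HH := nat_rect (fun n => {H : T n * R -> T n.+1 | pushes_to_base H})
  (exist (@pushes_to_base 0) H0 H0m)
  (fun n Hn => let H' := cid (push_to_base_step (svalP Hn)) in
     exist (@pushes_to_base n.+1) (sval H') (proj1 (svalP H'))).
have Hm n : pushes_to_base (sval (HH n)) := svalP (HH n).
have HS n x t : sval (HH n.+1) (base x, t) = base (sval (HH n) (x, unit_clamp t)).
  by rewrite /=; case: cid => H' /= [].
pose u n (x : T n) : R -> X := fun t => into (sval (HH n) (x, unit_clamp t)).
have ui n (x : T n) : u n.+1 (base x) = u n x.
  by apply/funext => t; rewrite /u HS unit_clamp_id into_base.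
have cu n : continuous (fun p : T n * R => u n p.1 p.2).
  apply: (@continuous_reparam _ _ (into \o sval (HH n))) => p.
  apply: continuous_comp; last exact: into_continuous.
  by case: (Hm n) => cH _ _; exact: cH.
pose K : X -> R -> X := colim_map u.
have K_into n (x : T n) : K (into x) = u n x by exact: colim_map_in.
have cK : continuous (K : X -> {compact-open, R -> X}).
  apply: (@colim_map_continuous _ _ _ _ _ {compact-open, R -> X}) => // n.
  exact: (continuous_curryR (cu n)).
exists (fun p => K p.1 p.2); split.
- apply: continuous_uncurryR => // y; have [n [x ->]] := colim_cover y.
  rewrite [K _]K_into.
  have cux : continuous (u n x) :=
    @continuous_slice _ _ (fun p : T n * R => u n p.1 p.2) x (cu n).
  exact: cux.
- move=> y; have [n [x ->]] := colim_cover y; rewrite /= [K _]K_into /u unit_clamp0.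
  by have [_ -> _] := Hm n; rewrite into_base.
- move=> y; have [n [x ->]] := colim_cover y; rewrite /= [K _]K_into /u unit_clamp1.
  by have [_ _ ->] := Hm n; exact: into_vertex.
Qed.
End Homotopy.
End Contraction.

(** The contraction joins every point to the vertex (1, m) with m its class, and a path
preserves the class. So pi_0 is M, and the contraction preserves components. *)
Lemma pi0_iso_bi_F1 (R : realType) (M : monoidType) (A : set M) :
  finite_set A -> is_nset_iso (@cayley_pi0_map M A) -> bi_F R 1 M.
Proof.
move=> fA pi0A; pose X := bicomplex R A; exists X, (bicomplex_cw R A).
split; last by move=> i; exact: bicomplex_cell_fg.
have [W Wm WE] := class_map R A.
have [H [cH H0 H1]] := bicomplex_contraction pi0A Wm WE.
pose vert (m : M) : X := colim_in (@tower_base_nmap R M A)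
  (@tower_base_inj R M A) (tower_vertex R A 0 1%g m).
have cHt x : continuous (fun t : R => H (x, t)).
  move=> t; apply: (@continuous_comp _ (X * R)%type _ (fun t => (x, t))); last exact: cH.
  by apply: continuous_pair; [exact: cst_continuous|exact: cvg_id].
have W_path x y : path_related R x y -> W x = W y.
  by move=> xy; apply: (@path_related_discrete R); exact: path_related_map (proj1 Wm) xy.
have vert_path x : path_related R x (vert (W x)).
  apply/path_relatedP; exists (fun t => H (x, t)); split=> //.
have Wvert m : W (vert m) = m by rewrite WE mul1g.
split.
  exists (fun C : pi0 R X => W (repr C)).
  have WC x : W (repr (\pi_(pi0 R X) x)) = W x.
    apply: W_path.
    have /eqmodP : \pi_(pi0 R X) (repr (\pi_(pi0 R X) x)) = \pi_(pi0 R X) x.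
      by rewrite reprK.
    exact.
  have We : equivariant (fun C : pi0 R X => W (repr C) : biset M).
    move=> a C; rewrite -[C in LHS]reprK.
    rewrite [nact a _](quot_nactE (@path_related_act R (bimonoid M) X)) WC.
    exact: (proj2 Wm).
  have gK : cancel (fun m : biset M => \pi_(pi0 R X) (vert m) : pi0 R X)
      (fun C : pi0 R X => W (repr C) : biset M).
    by move=> m; rewrite WC Wvert.
  have fK : cancel (fun C : pi0 R X => W (repr C) : biset M)
      (fun m : biset M => \pi_(pi0 R X) (vert m) : pi0 R X).
    move=> C; rewrite -[RHS]reprK; apply/eqmodP.
    by rewrite /= path_related_sym; exact: vert_path.
  split=> //; exists (fun m : biset M => \pi_(pi0 R X) (vert m) : pi0 R X).
  split=> // a m; apply: (can_inj fK).
  by rewrite We !gK.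
move=> x; pose T := path_component R X x.
have Tv : vert (W x) \in T by rewrite inE; exact: vert_path.
have TH (p : unit_interval R * T) : H (set_val p.2, set_val p.1) \in T.
  rewrite inE /T /path_component /=.
  apply: path_related_trans (set_valP p.2) _.
  have := path_related_map (R := R) (cHt (set_val p.2)).
  move=> /(_ 0 (set_val p.1)); rewrite H0; apply.
  apply/path_relatedP; exists (fun t => t * set_val p.1); split.
  - by move=> t; apply: cvgM; [exact: cvg_id|exact: cvg_cst].
  - by rewrite mul0r.
  - by rewrite mul1r.
exists (exist (fun y => y \in T) _ Tv).
exists (fun p => exist (fun y => y \in T) _ (TH p)); split.
- move=> p; apply: continuous_set_type.
  apply: (@continuous_comp _ (X * R)%type _
    (fun p : unit_interval R * T => (set_val p.2, set_val p.1))); last exact: cH.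
  apply: continuous_pair.
    apply: (@continuous_comp _ _ _ snd); [exact: cvg_snd|exact: set_val_continuous].
  apply: (@continuous_comp _ _ _ fst); [exact: cvg_fst|exact: set_val_continuous].
- by move=> y; apply: val_inj => /=; exact: H0.
- move=> y; apply: val_inj => /=; rewrite [LHS]H1; congr vert.
  by apply/esym/W_path; exact: (set_valP y).
Qed.

(** * Equivalence of the four conditions *)

Lemma monoid_fg_dominates (M : monoidType) :
  monoid_fg M -> exists2 A : set M, finite_set A & dominates A.
Proof.
move=> [A fA gen]; exists A => // N f g fg m.
have [s sA ->] := gen m; elim: s sA => [|a s ih] sA.
  by rewrite !big_nil !gmulf1.
rewrite !big_cons !gmulfM (fg a) ?ih //.
- by move=> b bs; apply: sA; rewrite in_cons bs orbT.
- by apply: sA; rewrite in_cons eqxx.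
Qed.

Theorem theorem7p10 (R : realType) (M : monoidType) :
  [/\ bi_F R 1 M <-> bi_FP 1 M,
      bi_FP 1 M <->
        (exists2 A : set M, finite_set A & is_nset_iso (@cayley_pi0_map M A)),
      (exists2 A : set M, finite_set A & is_nset_iso (@cayley_pi0_map M A)) <->
        (exists2 A : set M, finite_set A & dominates A)
    & monoid_fg M -> bi_F R 1 M].
Proof.
have dom_pi0 : (exists2 A : set M, finite_set A & dominates A) ->
    exists2 A : set M, finite_set A & is_nset_iso (@cayley_pi0_map M A).
  by move=> [A fA /dominates_pi0_iso isoA]; exists A.
have pi0_FP : (exists2 A : set M, finite_set A & is_nset_iso (@cayley_pi0_map M A)) ->
    bi_FP 1 M by move=> [A]; exact: pi0_iso_bi_FP1.
have pi0_F : (exists2 A : set M, finite_set A & is_nset_iso (@cayley_pi0_map M A)) ->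
    bi_F R 1 M by move=> [A]; exact: pi0_iso_bi_F1.
have FP_dom := @bi_FP1_dominates M.
have F_dom := @bi_F1_dominates R M.
split.
- by split=> [/F_dom/dom_pi0/pi0_FP|/FP_dom/dom_pi0/pi0_F].
- by split=> [/FP_dom/dom_pi0|/pi0_FP].
- by split=> [/pi0_FP/FP_dom|/dom_pi0].
- by move=> /monoid_fg_dominates/dom_pi0/pi0_F.
Qed.
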